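(* Let $\{T_w\}_{w\in U}$ be an interpolating family of operators between two interpolation scales $\{X_w\}_{w\in U}$ and $\{Y_w\}_{w\in U}$, and suppose that $\{Y_w\}_{w\in U}$ has the intersection property. Then the set of points $z\in U$ at which $T_z:X_z\to Y_z$ is a Fredholm operator is open in $U$, and the index is locally constant on this set. Moreover, for each $w\in U$ such that $T_w:X_w\to Y_w$ is Fredholm there exists a neighborhood $\omega\subseteq U$ of $w$ such that $\dim\operatorname{Ker}T_z\le\dim\operatorname{Ker}T_w$ and $\dim\operatorname{Coker}T_z\le\dim\operatorname{Coker}T_w$ for each $z\in\omega$.
   Context: All quasi-norms are assumed continuous. Fix a Hausdorff, locally compact, locally connected topological space $U$ (the space of parameters) and a continuous function $\delta:U\times U\to\mathbb{C}$ such that $\delta(z,w)=0$ if and only if $z=w$. Let $Z$ be a Hausdorff complex topological vector space (the ambient space). A family $\mathcal{F}$ of functions $U\to Z$ is called admissible (relative to $U,\delta,Z$) if: (1) $\mathcal{F}$ is a complex vector space with a quasi-norm $\|\cdot\|_{\mathcal{F}}$ for which it is complete; (2) for each $w\in U$ the evaluation map $\mathcal{F}\to Z$, $f\mapsto f(w)$, is continuous; (3) for each compact $K\subseteq U$ there is a positive constant $D_K(\mathcal{F})$ such that for any $w\in K$ and any $f\in\mathcal{F}$ with $f(w)=0$, the map $U\setminus\{w\}\ni z\mapsto f(z)/\delta(z,w)\in Z$ extends to an element of $\mathcal{F}$ with $\left\|f(\cdot)/\delta(\cdot,w)\right\|_{\mathcal{F}}\le D_K(\mathcal{F})\|f\|_{\mathcal{F}}$.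 The intermediate spaces are $X_w:=\{f(w): f\in\mathcal{F}\}\subseteq Z$, $w\in U$, with quasi-norm $\|x\|_w:=\inf\{\|f\|_{\mathcal{F}}: f\in\mathcal{F},\ f(w)=x\}$; they are quasi-Banach spaces. The collection $\{X_w\}_{w\in U}$ (also denoted $(U,\delta,Z,\mathcal{F})$) is called an interpolation scale. Let $\{X_w\}_{w\in U}$ be an interpolation scale with ambient space $Z$ and admissible family $\mathcal{F}$, and $\{Y_w\}_{w\in U}$ an interpolation scale with ambient space $W$ and admissible family $\mathcal{G}$ (same $U$ and $\delta$). A family of operators $T_w:X_w\to W$, $w\in U$, is called an interpolating family of operators if the assignment $\mathcal{F}\ni f\mapsto[U\ni w\mapsto T_w(f(w))]\in\mathcal{G}$ is well defined, linear, and satisfies $\|T_{\cdot}(f(\cdot))\|_{\mathcal{G}}\le M\|f\|_{\mathcal{F}}$ for all $f\in\mathcal{F}$, for some finite $M>0$. Then each $T_w$ maps $X_w$ linearly and boundedly into $Y_w$. Intersection property: for an interpolation scale $(U,\delta,Z,\mathcal{F})$ and a closed subspace $E$ of $Z$ put $\mathcal{F}_E:=\{f\in\mathcal{F}: f(U)\subseteq E\}$. The scale has the intersection property if there exists a closed subspace $\tilde Z$ of $Z$ such that $\mathcal{F}_{\tilde Z}$ is dense in $\mathcal{F}$ and, for each closed subspace $E$ of $\tilde Z$, $E=\bigcap_{w\in U}\{f(w): f\in\mathcal{F}_E\}$. A bounded linear operator is Fredholm if its kernel is finite dimensional and its range is closed of finite codimension; its index is $\dim\operatorname{Ker}-\dim\operatorname{Coker}$.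 *)

(* Defs.v *)
From HB Require Import structures.
From mathcomp Require Import all_boot all_order all_algebra.
From mathcomp Require Import all_classical all_reals all_analysis.
From mathcomp Require Import complex.

Set Implicit Arguments.
Unset Strict Implicit.
Unset Printing Implicit Defensive.

Import Order.TTheory GRing.Theory Num.Theory.
Import numFieldNormedType.Exports.

Local Open Scope classical_set_scope.
Local Open Scope ring_scope.

Definition locally_connected (U : topologicalType) :=
  forall (x : U) (V : set U), nbhs x V ->
    exists C : set U, [/\ open C, C x, connected C & C `<=` V].

Section Dimension.
Context {K : fieldType} {E : lmodType K}.

(* dim (A / B) = n for subspaces B `<=` A of E: the classes modulo B of
   e 0, ..., e n.-1 form a basis of A / B. With B = [set 0], dim A = n. *)
Definition has_qdim (A B : set E) (n : nat) :=
  exists2 e : 'I_n -> E, (forall i, A (e i)) &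
    forall x, A x -> exists! c : 'rV[K]_n, B (x - \sum_(i < n) c 0 i *: e i).

Definition finite_qdim (A B : set E) := exists n, has_qdim A B n.

(* Meaningful only under finite_qdim A B; it is 0 otherwise. *)
Definition qdim (A B : set E) : nat := xget 0%N [set n | has_qdim A B n].

End Dimension.

(* A quasi-normed space is given by a subspace A of an ambient vector space E
   together with a function N on E, of which only the values on A matter. *)
Section QuasiNorm.
Context {R : realType} {E : lmodType R[i]}.
Implicit Types (A B : set E) (N : E -> R).

Record continuous_quasi_norm A N : Prop := {
  qnorm_ge0 : forall x, A x -> 0 <= N x ;
  qnorm_eq0 : forall x, A x -> N x = 0 -> x = 0 ;
  qnormZ : forall (a : R[i]) x, A x -> N (a *: x) = complex.Re `|a| * N x ;
  qnormD : exists kappa : R, forall x y, A x -> A y ->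
    N (x + y) <= kappa * (N x + N y) ;
  qnorm_continuous : forall x, A x -> forall e : R, 0 < e ->
    exists2 d : R, 0 < d &
      forall y, A y -> N (y - x) < d -> `|N y - N x| < e
}.

Definition qcomplete A N :=
  forall u : nat -> E, (forall n, A (u n)) ->
    (forall e : R, 0 < e -> \forall m & n \near \oo, N (u m - u n) < e) ->
    exists2 l, A l & (fun n => N (u n - l)) @ \oo --> (0 : R).

(* B `<=` A is closed, resp. dense, for the topology of N on A. *)
Definition qclosed A N B :=
  forall x, A x -> (forall e : R, 0 < e -> exists2 y, B y & N (x - y) < e) ->
    B x.

Definition qdense A N B :=
  forall x, A x -> forall e : R, 0 < e -> exists2 y, B y & N (x - y) < e.

End QuasiNorm.

Section Fredholm.
Context {R : realType} {E E' : lmodType R[i]}.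
Variables (A : set E) (N : E -> R) (A' : set E') (N' : E' -> R) (t : E -> E').

Definition bounded_linear_on :=
  [/\ forall x, A x -> A' (t x),
      forall (a : R[i]) x y, A x -> A y -> t (a *: x + y) = a *: t x + t y
    & exists M : R, forall x, A x -> N' (t x) <= M * N x].

Definition ker_on : set E := [set x | A x /\ t x = 0].

Definition range_on : set E' := [set t x | x in A].

Definition fredholm :=
  [/\ bounded_linear_on,
      finite_qdim ker_on [set 0],
      qclosed A' N' range_on
    & finite_qdim A' range_on].

Definition fredholm_index : int :=
  (qdim ker_on [set 0])%:Z - (qdim A' range_on)%:Z.

End Fredholm.

Section Scale.
Context {R : realType} {U : topologicalType}.
Variable delta : U -> U -> R[i]^o.

Section Family.
Context {Z : topologicalLmodType R[i]}.
Variables (F : set (U -> Z)) (NF : (U -> Z) -> R).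

(* In [adm_div] the extension g is not required to be unique: at an isolated
   point w its value is not determined by the values of f. *)
Record admissible : Prop := {
  adm_submod : submod_closed [in F] ;
  adm_qnorm : continuous_quasi_norm F NF ;
  adm_complete : qcomplete F NF ;
  adm_eval : forall (w : U) f, F f -> forall V : set Z, nbhs (f w) V ->
    exists2 d : R, 0 < d & forall g, F g -> NF (g - f) < d -> V (g w) ;
  adm_div : forall K : set U, compact K -> exists2 D : R, 0 < D &
    forall w f, K w -> F f -> f w = 0 ->
      exists g, [/\ F g, forall z, z <> w -> g z = (delta z w)^-1 *: f z
                  & NF g <= D * NF f]
}.

Definition inter_space (w : U) : set Z := [set f w | f in F].

Definition inter_norm (w : U) (x : Z) : R :=
  inf [set NF f | f in [set f | F f /\ f w = x]].

Definition subfamily (E : set Z) : set (U -> Z) :=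
  [set f | F f /\ forall w, E (f w)].

Definition closed_subspace (E : set Z) := submod_closed [in E] /\ closed E.

Definition intersection_property :=
  exists Z' : set Z,
    [/\ closed_subspace Z',
        qdense F NF (subfamily Z')
      & forall E : set Z, closed_subspace E -> E `<=` Z' ->
          E = \bigcap_(w in [set: U]) [set f w | f in subfamily E]].

End Family.

Section Operators.
Context {Z W : topologicalLmodType R[i]}.
Variables (F : set (U -> Z)) (NF : (U -> Z) -> R).
Variables (G : set (U -> W)) (NG : (U -> W) -> R).
Variable T : U -> Z -> W.

Let lift (f : U -> Z) : U -> W := fun w => T w (f w).

(* T w stands for an operator defined on inter_space F w only; its values
   elsewhere are irrelevant here and below. *)
Definition interpolating_family :=
  [/\ forall f, F f -> G (lift f),
      forall (a : R[i]) f g, F f -> F g -> lift (a *: f + g) = a *: lift f + lift g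
    & exists2 M : R, 0 < M & forall f, F f -> NG (lift f) <= M * NF f].

Definition fredholm_at (w : U) :=
  fredholm (inter_space F w) (inter_norm F NF w)
           (inter_space G w) (inter_norm G NG w) (T w).

Definition index_at (w : U) : int :=
  fredholm_index (inter_space F w) (inter_space G w) (T w).

Definition ker_at (w : U) : set Z := ker_on (inter_space F w) (T w).

Definition range_at (w : U) : set W := range_on (inter_space F w) (T w).

End Operators.
End Scale.

(* Main.v *)
(* The kernels K_z = {f in F | f z = 0} depend continuously on z: dividing
   f in K_w by delta(., w) gives g in F with f - delta(z,w) g in K_z, so f lies
   within D |delta(z,w)| |f| of K_z, and symmetrically. The operator T_z is the
   map F/K_z -> G/K'_z induced by the single bounded operator f |-> T(f), so the
   theorem reduces to the stability of the Fredholm property when subspaces move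
   little in the gap sense. Adding to F a finite dimensional space that lifts
   Coker T_w makes the induced map onto at w; successive approximation
   then shows that it stays onto near w, with a kernel of constant dimension m,
   and bases move continuously. Near w, T_z is thus encoded by an m x n matrix C_z
   with dim Ker T_z = m - rank C_z and dim Coker T_z = n - rank C_z. *)
Require Import Defs.
From HB Require Import structures.
From mathcomp Require Import all_boot all_order all_algebra.
From mathcomp Require Import all_classical all_reals all_analysis.
From mathcomp Require Import complex ring lra.
Import Order.TTheory GRing.Theory Num.Theory.
Import numFieldNormedType.Exports.
Local Open Scope classical_set_scope.
Local Open Scope ring_scope.

Set Implicit Arguments.
Unset Strict Implicit.
Unset Printing Implicit Defensive.

(** Hahn-Banach fails in general quasi-Banach spaces, so bounded functionals and projections may be
    missing; the stability argument rests on open mapping and successive approximation alone. The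
    triangle inequality holds only up to a factor [k], paid again at each summation: errors must
    shrink by 1/(2k) instead of 1/2, which is the origin of the constants [(2 * k)^-1] and
    [2 * k ^+ 2]. No quotient space is formed. Surjectivity modulo Q becomes surjectivity of (x, q)
    |-> L x + q, and a basis modulo P becomes a bijection (a, p) |-> comb f a + p; both maps act
    between complete spaces, where open mapping applies. The rows of C_z are the second components
    of a basis of the kernel of (x, c) |-> T_z x + sum c_i v_i(z), so a C_z = 0 describes Ker T_z
    and the row space of C_z consists of the relations among the v_i(z) modulo the range. The size
    of C_z does not depend on z, whence the index m - n. Closedness of the range near w is not
    inherited from w; it is deduced from finite codimension. *)

Notation modulus a := (complex.Re `|a|).

(** * Moduli of complex scalars *)

Section Modulus.
Context {R : realType}.
Implicit Types a b : R[i].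

Lemma modulusE a : modulus a = Normc.normc a.
Proof. by case: a. Qed.

Lemma modulus_ge0 a : 0 <= modulus a.
Proof. by case: a => x y; exact: sqrtr_ge0. Qed.

Lemma modulusM a b : modulus (a * b) = modulus a * modulus b.
Proof. by rewrite !modulusE Normc.normcM. Qed.

Lemma modulusD a b : modulus (a + b) <= modulus a + modulus b.
Proof. by rewrite !modulusE le_normcD. Qed.

Lemma modulus_eq0 a : modulus a = 0 -> a = 0.
Proof. by rewrite modulusE; exact: Normc.eq0_normc. Qed.

Lemma modulusR (r : R) : modulus (r%:C)%C = `|r|.
Proof. by rewrite /= expr0n /= addr0 sqrtr_sqr. Qed.

Lemma modulusN1 : modulus (-1 : R[i]) = 1.
Proof. by rewrite /= oppr0 expr0n /= addr0 sqrrN expr1n sqrtr1. Qed.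

Lemma ler_Re_modulus a : `|complex.Re a| <= modulus a.
Proof.
case: a => x y /=; rewrite -sqrtr_sqr; apply: ler_wsqrtr.
by rewrite lerDl sqr_ge0.
Qed.

Lemma ler_Im_modulus a : `|complex.Im a| <= modulus a.
Proof.
case: a => x y /=; rewrite -sqrtr_sqr; apply: ler_wsqrtr.
by rewrite lerDr sqr_ge0.
Qed.

Lemma modulus_le_ReIm a : modulus a <= `|complex.Re a| + `|complex.Im a|.
Proof.
case: a => x y /=; rewrite -[leRHS]ger0_norm ?addr_ge0// -sqrtr_sqr.
apply: ler_wsqrtr; rewrite sqrrD !real_normK ?num_real//.
by rewrite lerD2r lerDl mulrn_wge0 ?mulr_ge0.
Qed.

End Modulus.

(** * Linear algebra relative to a subspace *)

Section Subspace.
Context {R : realType} {E : lmodType R[i]}.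
Variable A : set E.

Lemma submodP : submod_closed [in A] <->
  A 0 /\ forall (a : R[i]) x y, A x -> A y -> A (a *: x + y).
Proof.
split=> [[A0 Al]|[A0 Al]].
  split; first by rewrite inE in A0.
  by move=> a x y Ax Ay; move: (Al a x y); rewrite !inE; exact.
split; first by rewrite inE.
by move=> a x y; rewrite !inE; exact: Al.
Qed.

Hypothesis A_sub : submod_closed [in A].

Lemma submod0 : A 0.
Proof. by have [] := submodP.1 A_sub. Qed.

Lemma submodZD (a : R[i]) x y : A x -> A y -> A (a *: x + y).
Proof. by have [_] := submodP.1 A_sub; exact. Qed.

Lemma submodD x y : A x -> A y -> A (x + y).
Proof. by move=> Ax Ay; rewrite -(scale1r x); exact: submodZD. Qed.

Lemma submodZ (a : R[i]) x : A x -> A (a *: x).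
Proof. by move=> Ax; rewrite -(addr0 (_ *: _)); apply: submodZD => //; exact: submod0. Qed.

Lemma submodN x : A x -> A (- x).
Proof. by move=> Ax; rewrite -scaleN1r; exact: submodZ. Qed.

Lemma submodB x y : A x -> A y -> A (x - y).
Proof. by move=> Ax Ay; apply: submodD => //; exact: submodN. Qed.

Lemma submod_sum (I : finType) (x : I -> E) : (forall i, A (x i)) -> A (\sum_i x i).
Proof. by move=> Ax; apply: (big_ind A) => //; [exact: submod0|exact: submodD]. Qed.

Lemma submod_comb n (c : 'rV[R[i]]_n) (x : 'I_n -> E) :
  (forall i, A (x i)) -> A (\sum_i c 0 i *: x i).
Proof. by move=> Ax; apply: submod_sum => i; exact: submodZ. Qed.

End Subspace.

Section LinearOn.
Context {R : realType} {E E' : lmodType R[i]}.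

Definition linear_on (A : set E) (t : E -> E') :=
  forall (a : R[i]) x y, A x -> A y -> t (a *: x + y) = a *: t x + t y.

Variables (A : set E) (t : E -> E').
Hypotheses (A_sub : submod_closed [in A]) (t_lin : linear_on A t).

Lemma lin_onD x y : A x -> A y -> t (x + y) = t x + t y.
Proof. by move=> Ax Ay; have := t_lin 1 Ax Ay; rewrite !scale1r. Qed.

Lemma lin_on0 : t 0 = 0.
Proof.
have /esym/eqP := lin_onD (submod0 A_sub) (submod0 A_sub).
by rewrite addr0 -subr_eq0 addrK => /eqP.
Qed.

Lemma lin_onZ (a : R[i]) x : A x -> t (a *: x) = a *: t x.
Proof.
by move=> Ax; have := t_lin a Ax (submod0 A_sub); rewrite lin_on0 !addr0.
Qed.

Lemma lin_onN x : A x -> t (- x) = - t x.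
Proof. by move=> Ax; rewrite -scaleN1r lin_onZ// scaleN1r. Qed.

Lemma lin_onB x y : A x -> A y -> t (x - y) = t x - t y.
Proof.
by move=> Ax Ay; rewrite lin_onD ?lin_onN//; exact: submodN.
Qed.

Lemma lin_on_comb n (c : 'rV[R[i]]_n) (x : 'I_n -> E) :
  (forall i, A (x i)) -> t (\sum_i c 0 i *: x i) = \sum_i c 0 i *: t (x i).
Proof.
move=> Ax; pose P y z := A y /\ t y = z.
suff [] : P (\sum_i c 0 i *: x i) (\sum_i c 0 i *: t (x i)) by [].
apply: (big_ind2 P); first by split; [exact: submod0|exact: lin_on0].
- move=> y1 z1 y2 z2 [Ay1 <-] [Ay2 <-].
  by split; [exact: submodD|rewrite lin_onD].
- by move=> i _; split; [exact: submodZ|rewrite lin_onZ].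
Qed.

End LinearOn.

(** * Quasi-Banach subspaces *)

Section QBanach.
Context {R : realType}.

(* k is the modulus of concavity of N; as for continuous_quasi_norm, only the
   values of N on A matter. *)
Record qbanach {E : lmodType R[i]} (k : R) (A : set E) (N : E -> R) : Prop := QBanach {
  qb_sub : submod_closed [in A] ;
  qb_ge1 : 1 <= k ;
  qb_ge0 : forall x, A x -> 0 <= N x ;
  qb_eq0 : forall x, A x -> N x = 0 -> x = 0 ;
  qbZ : forall (a : R[i]) x, A x -> N (a *: x) = modulus a * N x ;
  qbD : forall x y, A x -> A y -> N (x + y) <= k * (N x + N y) ;
  qb_complete : qcomplete A N
}.

Section Theory.
Context {E : lmodType R[i]} (k : R) (A : set E) (N : E -> R).
Hypothesis AN : qbanach k A N.

Let A_sub := qb_sub AN.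
Let k_ge1 := qb_ge1 AN.
Let k_ge0 : 0 <= k.
Proof. exact: le_trans k_ge1. Qed.

Lemma qb0 : N 0 = 0.
Proof.
rewrite -(scale0r (0 : E)) (qbZ AN); last exact: submod0.
by rewrite (_ : modulus 0 = 0) ?mul0r// normr0.
Qed.

Lemma qbN x : A x -> N (- x) = N x.
Proof. by move=> Ax; rewrite -scaleN1r (qbZ AN)// modulusN1 mul1r. Qed.

Lemma qbBC x y : A x -> A y -> N (x - y) = N (y - x).
Proof. by move=> Ax Ay; rewrite -opprB qbN//; exact: submodB. Qed.

Lemma qbB x y : A x -> A y -> N (x - y) <= k * (N x + N y).
Proof.
by move=> Ax Ay; rewrite -(qbN Ay); apply: (qbD AN) => //; exact: submodN.
Qed.

Lemma qb_dist_triangle x y z : A x -> A y -> A z ->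
  N (x - z) <= k * (N (x - y) + N (y - z)).
Proof.
move=> Ax Ay Az; have -> : x - z = (x - y) + (y - z) by rewrite addrA subrK.
by apply: (qbD AN); apply: (submodB A_sub).
Qed.

Lemma qbR (r : R) x : A x -> N ((r%:C)%C *: x) = `|r| * N x.
Proof. by move=> Ax; rewrite (qbZ AN)// modulusR. Qed.

Lemma qb_sum n (x : 'I_n -> E) : (forall i, A (x i)) ->
  N (\sum_i x i) <= k ^+ n * \sum_i N (x i).
Proof.
elim: n x => [|n IH] x Ax; first by rewrite !big_ord0 qb0 mulr0.
rewrite !big_ord_recl.
apply: le_trans (qbD AN (Ax ord0) (submod_sum A_sub (fun i => Ax (lift ord0 i)))) _.
rewrite exprS -mulrA ler_wpM2l// mulrDr lerD//; last exact: IH.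
by rewrite ler_peMl ?(qb_ge0 AN)// exprn_ege1.
Qed.

Lemma qb_comb n (c : 'rV[R[i]]_n) (x : 'I_n -> E) (b : R) :
  (forall i, A (x i)) -> (forall i, N (x i) <= b) ->
  N (\sum_i c 0 i *: x i) <= k ^+ n * b * \sum_i modulus (c 0 i).
Proof.
move=> Ax xb; apply: le_trans (qb_sum (fun i => submodZ A_sub (c 0 i) (Ax i))) _.
rewrite -mulrA ler_wpM2l ?exprn_ge0// mulr_sumr ler_sum// => i _.
by rewrite (qbZ AN)// mulrC ler_wpM2r// modulus_ge0.
Qed.

(** One quasi-triangle inequality per step costs a factor [k], which the ratio 1/(2k) absorbs: by
    induction the distance from [s n] to any later term is at most k (r n + 2k r (n+1)) <= 2k r n.
    Passing to the limit costs one more [k], hence [2 * k ^+ 2]. *)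
Lemma qb_geometric (s : nat -> E) (r : nat -> R) :
  (forall n, A (s n)) -> (forall n, N (s n.+1 - s n) <= r n) ->
  (forall n, 2 * k * r n.+1 <= r n) ->
  exists2 l, A l & forall n, N (l - s n) <= 2 * k ^+ 2 * r n.
Proof.
move=> As sr rr.
have r_ge0 n : 0 <= r n.
  by apply: le_trans (sr n); rewrite (qb_ge0 AN)//; exact: submodB.
have tele j n : N (s (n + j)%N - s n) <= 2 * k * r n.
  elim: j n => [|j IH] n; first by rewrite addn0 subrr qb0 !mulr_ge0.
  apply: le_trans (qb_dist_triangle (As _) (As n.+1) (As _)) _.
  rewrite -addSnnS [2 * k]mulrC -mulrA ler_wpM2l// mulr_natl mulr2n.
  by rewrite lerD//; apply: le_trans (IH _) (rr n).
have rexp n : r n <= r 0%N * 2^-1 ^+ n.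
  elim: n => [|n IH]; first by rewrite expr0 mulr1.
  rewrite exprSr mulrA ler_pdivlMr//; apply: le_trans IH; apply: le_trans (rr n).
  by rewrite mulrC; have := ler_peMl (r_ge0 n.+1) k_ge1; lra.
have small e : 0 < e -> \forall n \near \oo, 2 * k * r n < e.
  move=> e0; have : (2 * k * (r 0%N)) * 2^-1 ^+ n @[n --> \oo] --> (2 * k * r 0%N * 0 : R).
    by apply: cvgMr; apply: cvg_expr; rewrite ger0_norm//; lra.
  rewrite mulr0 => /cvgr0Pnorm_lt/(_ _ e0); apply: filterS => n.
  apply: le_lt_trans; apply: le_trans (ler_norm _).
  by rewrite -[leRHS]mulrA ler_wpM2l// mulr_ge0.
have [|l Al sl] := qb_complete AN As.
  move=> e e0.
  have h (m n : nat) : (m <= n)%N -> 2 * k * r m < e -> N (s n - s m) < e.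
    by move=> mn; apply: le_lt_trans; rewrite -(subnKC mn).
  exists ([set n | 2 * k * r n < e], [set n | 2 * k * r n < e]) => /=.
    by split; exact: small.
  move=> [m n] [/= rm rn]; have [mn|/ltnW mn] := leqP m n; last exact: h.
  by rewrite qbBC//; exact: h.
exists l => // n; apply/ler_addgt0Pl => e e0.
have ek : 0 < e / k by rewrite divr_gt0// (lt_le_trans ltr01).
have /cvgr0Pnorm_lt/(_ _ ek) := sl.
move=> /(filterI (nbhs_infty_ge n)) /filter_ex[m /= [nm]].
rewrite ger0_norm; last by rewrite (qb_ge0 AN)//; exact: submodB.
rewrite qbBC// => lm; apply: le_trans (qb_dist_triangle Al (As m) (As n)) _.
have -> : e + 2 * k ^+ 2 * r n = k * (e / k + 2 * k * r n).
  by field; rewrite gt_eqF// (lt_le_trans ltr01).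
by rewrite ler_wpM2l// lerD// ?(ltW lm)// -(subnKC nm).
Unshelve. all: by end_near.
Qed.

Lemma qbanach_closed (B : set E) : submod_closed [in B] -> B `<=` A ->
  qclosed A N B -> qbanach k B N.
Proof.
move=> Bs BA Bc; split => //.
- by move=> x /BA; exact: (qb_ge0 AN).
- by move=> x /BA; exact: (qb_eq0 AN).
- by move=> a x /BA; exact: (qbZ AN).
- by move=> x y /BA Ax /BA Ay; exact: (qbD AN).
move=> u Bu uc; have [l Al ul] := qb_complete AN (fun n => BA _ (Bu n)) uc.
exists l => //; apply: Bc => // e e0.
have /cvgr0Pnorm_lt/(_ _ e0)/filter_ex[n] := ul.
rewrite ger0_norm; last by rewrite (qb_ge0 AN)//; apply: (submodB A_sub) => //; exact: BA.
by rewrite qbBC//; [exists (u n)|exact: BA].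
Qed.

End Theory.

Lemma qbanach_prod (E E' : lmodType R[i]) k (A : set E) N (B : set E') N' :
  qbanach k A N -> qbanach k B N' ->
  qbanach k (A `*` B) (fun p : E * E' => N p.1 + N' p.2).
Proof.
move=> AN BN; split.
- apply/submodP; split; first by split; [exact: submod0 (qb_sub AN)|exact: submod0 (qb_sub BN)].
  move=> a x y [x1 x2] [y1 y2].
  by split; [exact: submodZD (qb_sub AN) _ _ _ _ _|exact: submodZD (qb_sub BN) _ _ _ _ _].
- exact: qb_ge1 AN.
- by move=> x [x1 x2]; rewrite addr_ge0// ?(qb_ge0 AN)// (qb_ge0 BN).
- move=> [x y] [/= Ax By] /eqP.
  rewrite paddr_eq0 ?(qb_ge0 AN)// ?(qb_ge0 BN)// => /andP[/eqP x0 /eqP y0].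
  by rewrite (qb_eq0 AN Ax x0) (qb_eq0 BN By y0).
- by move=> a [x y] [/= Ax By]; rewrite (qbZ AN)// (qbZ BN)// mulrDr.
- move=> [x y] [x' y'] [/= Ax By] [/= Ax' By'].
  apply: le_trans (lerD (qbD AN Ax Ax') (qbD BN By By')) _.
  by rewrite -mulrDr addrACA.
move=> u Au uc.
have Au1 n : A (u n).1 by have [] := Au n.
have Au2 n : B (u n).2 by have [] := Au n.
have sb1 m n : A (u m - u n).1 by exact: submodB (qb_sub AN) _ _ _ _.
have sb2 m n : B (u m - u n).2 by exact: submodB (qb_sub BN) _ _ _ _.
have [|l Al ul] := qb_complete AN Au1.
  move=> e /uc; apply: filterS => -[m n] /=; apply: le_lt_trans.
  by rewrite lerDl (qb_ge0 BN (sb2 m n)).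
have [|l' Al' ul'] := qb_complete BN Au2.
  move=> e /uc; apply: filterS => -[m n] /=; apply: le_lt_trans.
  by rewrite lerDr (qb_ge0 AN (sb1 m n)).
exists (l, l') => //=.
by rewrite -(addr0 0); apply: cvgD.
Qed.

Definition row_norm {n} (c : 'rV[R[i]]_n) : R := \sum_i modulus (c 0 i).

Lemma row_norm_ge0 n (c : 'rV[R[i]]_n) : 0 <= row_norm c.
Proof. by apply: sumr_ge0 => i _; exact: modulus_ge0. Qed.

(** The triangle inequality holds here with constant 1; any [k >= 1] is allowed so that the product
    with a space of constant [k] keeps that constant. *)
Lemma qbanach_row k n : 1 <= k -> qbanach k [set: 'rV[R[i]]_n] row_norm.
Proof.
move=> k1; split => //.
- by apply/submodP.
- by move=> x _; exact: row_norm_ge0.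
- move=> x _ /eqP; rewrite psumr_eq0 => [|i _]; last exact: modulus_ge0.
  move=> /allP x0; apply/rowP => i; rewrite mxE; apply: modulus_eq0.
  by apply/eqP/x0; rewrite mem_index_enum.
- by move=> a x _; rewrite /row_norm mulr_sumr; apply: eq_bigr => i _; rewrite mxE modulusM.
- move=> x y _ _; apply: (@le_trans _ _ (row_norm x + row_norm y)).
    rewrite /row_norm -big_split/=; apply: ler_sum => i _; rewrite mxE; exact: modulusD.
  by rewrite ler_peMl// addr_ge0// row_norm_ge0.
move=> u _ uc.
have coord i : exists l : R[i], modulus (u n 0 i - l) @[n --> \oo] --> (0 : R).
  (* [p] will be the real and the imaginary part, which reduces completeness to that of the
     reals. *)
  have cvg_part (p : R[i] -> R) : (forall a, `|p a| <= modulus a) ->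
      (forall a b, p (a - b) = p a - p b) -> cvg (p (u n 0 i) @[n --> \oo]).
    move=> pm pB; apply: cauchy_cvg; apply: cauchy_exP => e e0.
    have [[P Q] [/= Pn Qn] PQ] := uc _ e0.
    have [j Pj] := filter_ex Pn.
    exists (p (u j 0 i)); apply: filterS Qn => m Qm /=.
    rewrite /ball/= -pB; apply: le_lt_trans (PQ (j, m) _) => //=.
    apply: le_trans (pm _) _.
    rewrite /row_norm (bigD1 i)//= !mxE lerDl.
    by apply: sumr_ge0 => i1 _; exact: modulus_ge0.
  have /cvg_ex[a ua] : cvg (complex.Re (u n 0 i) @[n --> \oo]).
    by apply: cvg_part; [exact: ler_Re_modulus|case=> ? ? []].
  have /cvg_ex[b ub] : cvg (complex.Im (u n 0 i) @[n --> \oo]).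
    by apply: cvg_part; [exact: ler_Im_modulus|case=> ? ? []].
  exists (a +i* b)%C.
  apply/cvgr0Pnorm_lt => e e0; have e20 : 0 < e / 2 by rewrite divr_gt0.
  move/cvgrPdist_lt/(_ _ e20) : ua => ua; move/cvgrPdist_lt/(_ _ e20) : ub => ub.
  near=> j; rewrite ger0_norm ?modulus_ge0//.
  apply: le_lt_trans (modulus_le_ReIm _) _; rewrite [ltRHS]splitr ltrD//.
    suff : `|a - complex.Re (u j 0 i)| < e / 2 by rewrite distrC; case: (u j 0 i).
    by near: j.
  suff : `|b - complex.Im (u j 0 i)| < e / 2 by rewrite distrC; case: (u j 0 i).
  by near: j.
have /choice[l ul] := coord.
exists (\row_i l i) => //.
have addc : continuous (fun x : R * R => x.1 + x.2) by exact: add_continuous.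
suff : row_norm (u j - \row_i l i) @[j --> \oo] --> (\sum_(i < n) 0 : R).
  by rewrite big1.
apply: (@cvg_big R 'I_n _ 0 xpredT addc nat \oo (index_enum _)
  (fun i j => modulus ((u j - \row_i l i) 0 i)) (fun=> 0) _) => i _.
have -> : (fun j => modulus ((u j - \row_i l i) 0 i)) = (fun j => modulus (u j 0 i - l i)).
  by apply/funext => j; rewrite !mxE.
exact: ul.
Unshelve. all: by end_near.
Qed.

End QBanach.

(** * The open mapping theorem *)

Section OpenMapping.
Context {R : realType}.

Lemma le0_geometric (a b : R) : (forall n, a <= b * 2^-1 ^+ n) -> a <= 0.
Proof.
move=> ab; have h : b * 2^-1 ^+ n @[n --> \oo] --> (b * 0 : R).
  by apply: cvgMr; apply: cvg_expr; rewrite ger0_norm//; lra.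
rewrite mulr0 in h; rewrite -(cvg_lim (@Rhausdorff R) h).
apply: limr_ge; first by apply/cvg_ex; exists 0.
exact: nearW.
Qed.

Context {E E' : lmodType R[i]} (k : R).
Variables (A : set E) (N : E -> R) (B : set E') (N' : E' -> R) (t : E -> E') (M : R).
Hypotheses (AN : qbanach k A N) (BN : qbanach k B N').
Hypotheses (tAB : forall x, A x -> B (t x)) (t_lin : linear_on A t).
Hypotheses (M_ge0 : 0 <= M) (t_bd : forall x, A x -> N' (t x) <= M * N x).

Let As := qb_sub AN.
Let Bs := qb_sub BN.
Let k_ge1 := qb_ge1 AN.
Let k_gt0 : 0 < k.
Proof. exact: lt_le_trans k_ge1. Qed.

(** Successive approximation: lifting the residual again and again divides it by 2k each time, so
    the corrections form a series to which [qb_geometric] applies. This is the engine of both the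
    open mapping theorem and the perturbation results. *)
Lemma approx_lift (C : R) : 0 <= C ->
  (forall y, B y -> exists2 x, A x &
     N x <= C * N' y /\ N' (y - t x) <= (2 * k)^-1 * N' y) ->
  forall y, B y -> exists2 x, A x & t x = y /\ N x <= 2 * k ^+ 2 * C * N' y.
Proof.
move=> C0 H y By.
have [g gP] : {g : E' -> E & forall z, B z ->
    [/\ A (g z), N (g z) <= C * N' z & N' (z - t (g z)) <= (2 * k)^-1 * N' z]}.
  apply: (choice (P := fun z x => B z -> [/\ A x, N x <= C * N' z
     & N' (z - t x) <= (2 * k)^-1 * N' z])) => z.
  have [Bz|nBz] := pselect (B z); last by exists 0.
  by have [x Ax [? ?]] := H z Bz; exists x.
(* Partial sums of the corrections; [y - t (s n)] is the residual still to be lifted. *)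
pose s := fix s n := if n is m.+1 then s m + g (y - t (s m)) else 0.
have sA n : A (s n).
  elim: n => [|n IH] /=; first exact: submod0.
  by apply: submodD => //; have [] := gP _ (submodB Bs By (tAB IH)).
have yB n : B (y - t (s n)) by apply: submodB => //; exact: tAB.
pose d n := N' (y - t (s n)).
have d_ge0 n : 0 <= d n by exact: (qb_ge0 BN).
have dS n : 2 * k * d n.+1 <= d n.
  have [gA _ dn] := gP _ (yB n).
  rewrite mulrC -ler_pdivlMr ?mulr_gt0// mulrC /d /=.
  by rewrite (lin_onD t_lin)// opprD addrA.
have [n|n|l Al ls] := qb_geometric AN sA (r := fun n => C * d n).
- have [gA gN _] := gP _ (yB n).
  by rewrite /= addrAC subrr add0r.
- by rewrite mulrCA ler_wpM2l.
exists l => //; split; last first.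
  have := ls 0%N; rewrite subr0 mulrA => /le_trans; apply.
  by rewrite /d /= (lin_on0 As t_lin) subr0.
have dexp n : d n <= d 0%N * 2^-1 ^+ n.
  elim: n => [|n IH]; first by rewrite expr0 mulr1.
  rewrite exprSr mulrA ler_pdivlMr//; apply: le_trans IH; apply: le_trans (dS n).
  by rewrite mulrC; have := ler_peMl (d_ge0 n.+1) k_ge1; lra.
have Btl := tAB Al.
apply/esym/eqP; rewrite -subr_eq0; apply/eqP/(qb_eq0 BN); first exact: submodB.
apply/eqP; rewrite eq_le (qb_ge0 BN) ?andbT; last exact: submodB.
apply: (@le0_geometric _ (k * (1 + M * (2 * k ^+ 2 * C)) * d 0%N)) => n.
apply: le_trans (qb_dist_triangle BN By (tAB (sA n)) Btl) _.
rewrite -!mulrA ler_wpM2l ?(ltW k_gt0)// mulrDl mul1r lerD//; first exact: dexp.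
rewrite (qbBC BN)//; last exact: tAB.
rewrite -(lin_onB As t_lin)//; apply: le_trans (t_bd (submodB As Al (sA n))) _.
rewrite -!mulrA ler_wpM2l//; apply: le_trans (ls n) _.
by rewrite -!mulrA !ler_wpM2l ?exprn_ge0 ?(ltW k_gt0).
Qed.

Hypothesis t_surj : forall y, B y -> exists2 x, A x & t x = y.

(* Baire's argument: otherwise one builds nested balls avoiding in turn the
   images of all the balls of A, and their common point is not a value of t. *)
Lemma image_ball_somewhere_dense :
  exists n y0 (r : R), [/\ B y0, 0 < r & forall y, B y -> N' (y - y0) <= r ->
    forall e : R, 0 < e -> exists2 x, A x & N x <= n%:R :> R /\ N' (y - t x) < e].
Proof.
apply: contrapT => H.
(* The centre of [q] lies in the ball [p], and the radius shrinks by 2k so that the centres satisfy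
   [qb_geometric]. The image of the [n]-ball keeps away from the new centre by more than
   [2 * k ^+ 2] radii, which is the bound on the distance from that centre to the limit. *)
pose good n (p q : E' * R) := [/\ B q.1, 0 < q.2, N' (q.1 - p.1) <= p.2,
  2 * k * q.2 <= p.2 &
  forall x, A x -> N x <= n%:R -> 2 * k ^+ 2 * q.2 < N' (q.1 - t x)].
have [h hP] : {h : nat * (E' * R) -> E' * R & forall np, B np.2.1 -> 0 < np.2.2 ->
    good np.1 np.2 (h np)}.
  apply: (choice (P := fun np q => B np.2.1 -> 0 < np.2.2 -> good np.1 np.2 q)).
  move=> [n [y0 r]] /=; apply: contrapT => Hnp; apply: H; exists n, y0, r.
  have [By0|nB] := pselect (B y0); last by exfalso; apply: Hnp; exists (0, 0) => /nB.
  have [r0|nr] := boolP (0 < r); last first.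
    by exfalso; apply: Hnp; exists (0, 0) => _; rewrite (negbTE nr).
  split => // y By yy0 e e0; apply: contrapT => Hx; apply: Hnp.
  (* The first term gives the shrinking by 2k; with the second, [2 * k ^+ 2] radii amount to at most
     [e / 2], less than the distance [e] by which the image misses [y]. *)
  exists (y, Num.min (r / (2 * k)) (e / (4 * k ^+ 2))) => _ _.
  have k2 : 0 < k ^+ 2 by rewrite exprn_gt0.
  split => //=.
  - by rewrite lt_min !divr_gt0// mulr_gt0.
  - by rewrite mulrC -ler_pdivlMr ?mulr_gt0// ge_min lexx.
  - move=> x Ax xn; rewrite ltNge; apply/negP => hx; apply: Hx; exists x => //.
    split => //; apply: le_lt_trans hx _.
    apply: (@le_lt_trans _ _ (2 * k ^+ 2 * (e / (4 * k ^+ 2)))).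
      by rewrite ler_pM2l ?mulr_gt0// ge_min lexx orbT.
    have -> : 2 * k ^+ 2 * (e / (4 * k ^+ 2)) = e / 2.
      by field; rewrite gt_eqF.
    by rewrite ltr_pdivrMr// ltr_pMr// ltr1n.
pose p := fix p n := if n is m.+1 then h (m, p m) else (0 : E', 1 : R).
have pB n : B (p n).1 /\ 0 < (p n).2.
  elim: n => [|n [IB I0]] /=; first by split => //; exact: submod0.
  by have [] := hP (n, p n) IB I0.
have pP n : good n (p n) (p n.+1) by have [IB I0] := pB n; exact: (hP (n, p n)).
have [|n|n|l Bl ls] := qb_geometric BN (s := fun n => (p n).1) (r := fun n => (p n).2).
- by move=> n; have [] := pB n.
- by have [] := pP n.
- by have [] := pP n.
have [x Ax txl] := t_surj Bl.
pose n := (Num.truncn (N x)).+1.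
(* The preimage [x] of the limit lies in the [n]-ball, so the limit should be farther from centre
   [n.+1] than [ls] permits. *)
have [_ _ _ _ /(_ x Ax)] := pP n.
rewrite ltNge txl (qbBC BN)//; last by have [] := pB n.+1.
rewrite ls => /(_ _) hn; suff : false by []; apply: hn.
exact/ltW/truncnS_gt.
Qed.

(** Density near some [y0] is carried to the origin by subtraction and to all of [B] by homogeneity;
    this yields approximate lifts, which [approx_lift] makes exact. *)
Theorem open_mapping :
  exists2 C : R, 0 <= C & forall y, B y -> exists2 x, A x & t x = y /\ N x <= C * N' y.
Proof.
have [n [y0 [r [By0 r0 dense]]]] := image_ball_somewhere_dense.
have near0 y : B y -> N' y <= r -> exists2 x, A x &
    N x <= 2 * k * n%:R /\ N' (y - t x) <= (2 * k)^-1 * r.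
  move=> By yr.
  (* The approximations of [y0 + y] and [y0] each have error below r/(4k^2); their difference then
     has error at most r/(2k), the contraction wanted by [approx_lift]. *)
  have e0 : 0 < (2 * k)^-1 * r / (2 * k) by rewrite ?(divr_gt0, mulr_gt0, invr_gt0).
  have [|x1 Ax1 [x1n x1e]] := dense _ (submodD Bs By0 By) _ _ e0.
    by rewrite addrAC subrr add0r.
  have [|x2 Ax2 [x2n x2e]] := dense _ By0 _ _ e0.
    by rewrite subrr (qb0 BN) ltW.
  exists (x1 - x2); first exact: submodB.
  split.
    apply: le_trans (qbB AN Ax1 Ax2) _.
    by rewrite [2 * k]mulrC -mulrA ler_pM2l//; lra.
  rewrite (lin_onB As t_lin)//.
  have -> : y - (t x1 - t x2) = (y0 + y - t x1) - (y0 - t x2).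
    by rewrite -[y0 + y - _]addrA [y0 + (_ - _)]addrC addrKA opprK opprB addrA addrAC.
  apply: le_trans (qbB BN _ _) _; do ?[apply: (submodB Bs)|apply: (submodD Bs)|exact: tAB] => //.
  rewrite -[leRHS](@divfK _ (2 * k)) ?gt_eqF ?mulr_gt0// [leRHS]mulrC [2 * k]mulrC -mulrA.
  by rewrite ler_pM2l//; lra.
pose C := 2 * k * n%:R / r.
have C0 : 0 <= C by apply: divr_ge0; [rewrite !mulr_ge0// ltW|exact: ltW].
exists (2 * k ^+ 2 * C); first by rewrite mulr_ge0// mulr_ge0// exprn_ge0// ltW.
apply: approx_lift => // y By.
(* Vectors of norm 0 cannot be rescaled to norm [r] and are lifted by 0. *)
have [Ny0|Ny0] := eqVneq (N' y) 0.
  exists 0; first exact: submod0.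
  by rewrite (qb0 AN) Ny0 !mulr0 (lin_on0 As t_lin) subr0 Ny0 lexx.
have Ny_gt0 : 0 < N' y by rewrite lt_def Ny0 (qb_ge0 BN).
pose c : R := r / N' y; have c0 : 0 < c by rewrite divr_gt0.
have [||x Ax [xn xe]] := near0 ((c%:C)%C *: y); first exact: submodZ.
  by rewrite (qbR BN)// gtr0_norm// /c divfK.
exists (((c^-1)%:C)%C *: x); first exact: submodZ.
have cV : 0 <= c^-1 by rewrite invr_ge0 ltW.
split.
  rewrite (qbR AN)// ger0_norm//; apply: le_trans (ler_wpM2l cV xn) _.
  by rewrite /C /c invf_div le_eqVlt; apply/orP; left; apply/eqP; ring.
rewrite (lin_onZ As t_lin)//.
have -> : y - ((c^-1)%:C)%C *: t x = ((c^-1)%:C)%C *: ((c%:C)%C *: y - t x).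
  rewrite scalerBr scalerA (_ : _ * _ = 1) ?scale1r//; apply/eqP.
  by rewrite eq_complex /= !mulr0 !mul0r subr0 addr0 mulVf ?eqxx // lt0r_neq0.
have Bd : B ((c%:C)%C *: y - t x) by apply: submodB => //; [exact: submodZ|exact: tAB].
rewrite (qbR BN)// ger0_norm//; apply: le_trans (ler_wpM2l cV xe) _.
by rewrite mulrCA /c invf_div divfK ?gt_eqF.
Qed.

End OpenMapping.

(** * Stability under small gap perturbations *)

Section ClosedSubspace.
Context {R : realType} {E : lmodType R[i]} (A : set E) (N : E -> R).

Definition qclosed_subspace (P : set E) :=
  [/\ submod_closed [in P], P `<=` A & qclosed A N P].

Lemma qclosed_subspace_qbanach k P :
  qbanach k A N -> qclosed_subspace P -> qbanach k P N.
Proof. by move=> AN [Ps PA Pc]; exact: (qbanach_closed AN). Qed.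

(** The one-sided gap of subspaces, with an approximant attaining the bound required in place of an
    infimum. *)
Definition almost_in (e : R) (P Q : set E) :=
  forall p, P p -> exists2 q, Q q & N (p - q) <= e * N p.

Lemma almost_in_le k e e' P Q : qbanach k A N -> P `<=` A ->
  e <= e' -> almost_in e P Q -> almost_in e' P Q.
Proof.
move=> AN PA ee' PQ p Pp; have [q Qq pq] := PQ p Pp; exists q => //.
by apply: le_trans pq _; rewrite ler_wpM2r// (qb_ge0 AN)//; exact: PA.
Qed.

Definition comb n (f : 'I_n -> E) (c : 'rV[R[i]]_n) : E := \sum_(j < n) c 0 j *: f j.

Lemma comb_linear n (f : 'I_n -> E) (a : R[i]) c d :
  comb f (a *: c + d) = a *: comb f c + comb f d.
Proof.
rewrite /comb scaler_sumr -big_split/=; apply: eq_bigr => i _.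
by rewrite !mxE scalerDl scalerA.
Qed.

Lemma comb0 n (f : 'I_n -> E) : comb f 0 = 0.
Proof. by rewrite /comb big1// => i _; rewrite mxE scale0r. Qed.

Lemma combD n (f : 'I_n -> E) c d : comb f (c + d) = comb f c + comb f d.
Proof. by have := comb_linear f 1 c d; rewrite !scale1r. Qed.

Lemma combN n (f : 'I_n -> E) c : comb f (- c) = - comb f c.
Proof. by have := comb_linear f (-1) c 0; rewrite comb0 !addr0 !scaleN1r. Qed.

Lemma combB n (f : 'I_n -> E) c d : comb f (c - d) = comb f c - comb f d.
Proof. by rewrite combD combN. Qed.

Lemma comb_subr n (f g : 'I_n -> E) c :
  comb (fun j => f j - g j) c = comb f c - comb g c.
Proof.
by rewrite /comb -sumrB; apply: eq_bigr => i _; rewrite scalerBr.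
Qed.

Lemma comb_mulmx m n (f : 'I_n -> E) (C : 'M[R[i]]_(m, n)) (c : 'rV_m) :
  comb f (c *m C) = comb (fun i => comb f (row i C)) c.
Proof.
rewrite /comb; under eq_bigr do rewrite mxE scaler_suml.
rewrite exchange_big; apply: eq_bigr => i _; rewrite scaler_sumr.
by apply: eq_bigr => j _; rewrite mxE scalerA.
Qed.

Variables (k : R) (n : nat) (f : 'I_n -> E).
Hypotheses (AN : qbanach k A N) (Af : forall j, A (f j)).

Lemma comb_in c : A (comb f c).
Proof. exact: (submod_comb (qb_sub AN)). Qed.

Lemma comb_le b c : (forall j, N (f j) <= b) ->
  N (comb f c) <= k ^+ n * b * row_norm c.
Proof. by move=> fb; exact: (qb_comb AN). Qed.

Lemma comb_bounded : exists2 b, 0 <= b & forall j, N (f j) <= b.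
Proof.
exists (\sum_j N (f j)); first by apply: sumr_ge0 => j _; exact: (qb_ge0 AN).
move=> j; rewrite (bigD1 j)//= lerDl; apply: sumr_ge0 => i _; exact: (qb_ge0 AN).
Qed.

End ClosedSubspace.

Section Preimage.
Context {R : realType} {E E' : lmodType R[i]} (k : R).
Variables (A : set E) (N : E -> R) (B : set E') (N' : E' -> R) (L : E -> E') (M : R).
Hypotheses (AN : qbanach k A N) (BN : qbanach k B N').
Hypotheses (LAB : forall x, A x -> B (L x)) (L_lin : linear_on A L).
Hypotheses (M_ge0 : 0 <= M) (L_bd : forall x, A x -> N' (L x) <= M * N x).

Definition preim_sub (Q : set E') : set E := [set x | A x /\ Q (L x)].

Lemma preim_qclosed Q : qclosed_subspace B N' Q -> qclosed_subspace A N (preim_sub Q).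
Proof.
move=> [Qs QB Qc]; have As := qb_sub AN; split.
- apply/submodP; split; first by split; [exact: submod0|rewrite (lin_on0 As L_lin); exact: submod0].
  move=> a x y [Ax Qx] [Ay Qy]; split; first exact: submodZD.
  by rewrite L_lin//; exact: submodZD.
- by move=> x [].
move=> x Ax H; split=> //; apply: Qc; first exact: LAB.
(* [M] may be 0, hence the division by [M + 1]. *)
move=> e e0; have e1 : 0 < e / (M + 1) by rewrite divr_gt0// ltr_wpDl.
have [y [Ay Qy] xy] := H _ e1; exists (L y) => //.
rewrite -(lin_onB As L_lin)//; have Axy := submodB As Ax Ay.
apply: le_lt_trans (L_bd Axy) _.
move: xy; rewrite ltr_pdivlMr ?ltr_wpDl// mulrC => /(le_lt_trans _); apply.
by rewrite ler_wpM2r ?(qb_ge0 AN)// lerDl.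
Qed.

(** Open mapping for (x, q) |-> L x + q on [A] times [Q], a substitute for the quotient of [B] by
    [Q]. *)
Lemma modulo_surj_bounded Q : qclosed_subspace B N' Q ->
  (forall y, B y -> exists2 x, A x & Q (y - L x)) ->
  exists2 C, 0 <= C & forall y, B y ->
    exists x q, [/\ A x, Q q, y = L x + q & N x + N' q <= C * N' y].
Proof.
move=> Qcs surj; have QN := qclosed_subspace_qbanach BN Qcs; have [Qs QB Qc] := Qcs.
have k0 : 0 <= k by apply: le_trans (qb_ge1 AN).
have Bs := qb_sub BN.
have [| | | | |C C0 HC] := @open_mapping _ _ _ _ _ _ _ _
    (fun p : E * E' => L p.1 + p.2) (k * (M + 1)) (qbanach_prod AN QN) BN.
- by move=> [x q] [/= Ax /QB Bq]; apply: submodD => //; exact: LAB.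
- by move=> a [x q] [x' q'] [/= Ax Qq] [/= Ax' Qq']; rewrite L_lin// scalerDr addrACA.
- by rewrite mulr_ge0// addr_ge0.
- move=> [x q] [/= Ax Qq].
  apply: le_trans (qbD BN (LAB Ax) (QB _ Qq)) _; rewrite -mulrA ler_wpM2l//.
  have := L_bd Ax; have := qb_ge0 AN Ax; have := qb_ge0 QN Qq; have := M_ge0; nra.
- move=> y By; have [x Ax Qx] := surj y By; exists (x, y - L x) => //=.
  by rewrite addrC subrK.
exists C => // y By; have [[x q] [/= Ax Qq] [<- xq]] := HC y By.
by exists x, q.
Qed.

End Preimage.

Section Stability.
Context {R : realType} {E E' : lmodType R[i]} (k : R).
Variables (A : set E) (N : E -> R) (B : set E') (N' : E' -> R) (L : E -> E') (M : R).
Hypotheses (AN : qbanach k A N) (BN : qbanach k B N').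
Hypotheses (LAB : forall x, A x -> B (L x)) (L_lin : linear_on A L).
Hypotheses (M_ge0 : 0 <= M) (L_bd : forall x, A x -> N' (L x) <= M * N x).

Let As := qb_sub AN.
Let Bs := qb_sub BN.
Let k_ge1 := qb_ge1 AN.
Let k_gt0 : 0 < k.
Proof. exact: lt_le_trans k_ge1. Qed.

Section CombMap.
Variables (m : nat) (f : 'I_m -> E) (P : set E).
Hypotheses (Af : forall j, A (f j)) (PA : qclosed_subspace A N P).

Let PN := qclosed_subspace_qbanach AN PA.

(** When it maps the rows and [P] bijectively onto a subspace, [f] is a basis of that subspace
    modulo [P]; in this form the basis property is accessible to open mapping. *)
Definition comb_map (ap : 'rV[R[i]]_m * E) := comb f ap.1 + ap.2.

Lemma comb_map_linear : linear_on ([set: 'rV[R[i]]_m] `*` P) comb_map.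
Proof.
by move=> a [c x] [d y] _ _; rewrite /comb_map/= comb_linear scalerDr addrACA.
Qed.

Lemma comb_map_bounded : exists2 C, 0 <= C & forall ap, ([set: 'rV[R[i]]_m] `*` P) ap ->
  N (comb_map ap) <= C * (row_norm ap.1 + N ap.2).
Proof.
have [b b0 fb] := comb_bounded AN Af.
have k0 := ltW k_gt0.
have kb : 0 <= k ^+ m * b by rewrite mulr_ge0// exprn_ge0.
exists (k * (k ^+ m * b + 1)); first by rewrite mulr_ge0// addr_ge0.
have [_ PA' _] := PA.
move=> [c x] [_ /= Px]; apply: le_trans (qbD AN (comb_in AN Af c) (PA' _ Px)) _.
rewrite -mulrA ler_wpM2l//.
have := comb_le AN Af c fb; have := row_norm_ge0 c; have := qb_ge0 PN Px; nra.
Qed.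

Lemma comb_map_qbanach :
  qbanach k ([set: 'rV[R[i]]_m] `*` P) (fun ap => row_norm ap.1 + N ap.2).
Proof. exact: qbanach_prod (qbanach_row m k_ge1) PN. Qed.

End CombMap.

Variables (P0 : set E) (Q0 : set E') (m : nat) (u : 'I_m -> E).
Hypotheses (P0A : qclosed_subspace A N P0) (Q0B : qclosed_subspace B N' Q0).
Hypotheses (LP0 : forall x, P0 x -> Q0 (L x)).
Hypotheses (Au : forall j, A (u j)) (LQu : forall j, Q0 (L (u j))).
Hypothesis surj0 : forall y, B y -> exists2 x, A x & Q0 (y - L x).
Hypothesis basis0 : forall x, A x -> Q0 (L x) -> exists! a, P0 (x - comb u a).

(** Write y = L x + q with q in [Q0] and bounds, then replace q by a nearby q' in [Q]. The error q -
    q' is at most a 1/(2k) fraction of [y], so the procedure can be iterated. The constants serve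
    all [Q] close to [Q0]. *)
Lemma surj_stable : exists e C : R, [/\ 0 < e, 0 <= C &
  forall Q, qclosed_subspace B N' Q -> almost_in N' e Q0 Q ->
    forall y, B y -> exists x, [/\ A x, Q (y - L x) & N x <= C * N' y]].
Proof.
have [C C0 HC] := modulo_surj_bounded AN BN LAB L_lin M_ge0 L_bd Q0B surj0.
have k0 := ltW k_gt0.
(* Since q is bounded by C times z, a gap e with e (1 + C) = 1/(2k) makes the error contract; the
   summand 1 guards against C = 0 and gives e <= 1. *)
pose e := ((1 + C) * (2 * k))^-1.
have e_gt0 : 0 < e by rewrite invr_gt0 !mulr_gt0// ltr_wpDr.
have eC : e * (1 + C) = (2 * k)^-1.
  by rewrite /e invfM mulrAC mulVf ?mul1r// gt_eqF// ltr_wpDr.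
have e1 : e <= 1.
  have : (2 * k)^-1 <= 1 by rewrite invf_le1 ?mulr_gt0//; move: k_ge1; lra.
  by rewrite -eC; nra.
(* In one step x costs [C], and q' costs at most k (C + C), because e <= 1 keeps q - q' below C
   times z. The prefactor comes from [approx_lift]. *)
exists e, (2 * k ^+ 2 * (C + k * (2 * C))); split => //.
  by rewrite !(mulr_ge0, addr_ge0)// exprn_ge0.
move=> Q Qcs Q0Q y By; have QN := qclosed_subspace_qbanach BN Qcs.
have [Qs QB _] := Qcs; have [Q0s Q0B' _] := Q0B.
have [||||||[x q] [/= Ax Qq] [<- xq]] := @approx_lift _ _ _ _ _ _ _ _
  (fun p : E * E' => L p.1 + p.2) (k * (M + 1)) (qbanach_prod AN QN) BN _ _ _ _
    (C + k * (2 * C)) _ _ y By.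
- by move=> [x q] [/= Ax /QB Bq]; apply: submodD => //; exact: LAB.
- by move=> a [x q] [x' q'] [/= Ax Qq] [/= Ax' Qq']; rewrite L_lin// scalerDr addrACA.
- by rewrite mulr_ge0// addr_ge0.
- move=> [x q] [/= Ax Qq].
  apply: le_trans (qbD BN (LAB Ax) (QB _ Qq)) _; rewrite -mulrA ler_wpM2l//.
  have := L_bd Ax; have := qb_ge0 AN Ax; have := qb_ge0 QN Qq; have := M_ge0; nra.
- by rewrite !(mulr_ge0, addr_ge0).
- move=> z Bz; have [x [q [Ax Q0q zE xq]]] := HC z Bz.
  have [q' Qq' qq'] := Q0Q q Q0q.
  have Bq := Q0B' _ Q0q; have Bq' := QB _ Qq'.
  have Nx := qb_ge0 AN Ax; have Nq := qb_ge0 BN Bq; have Nz := qb_ge0 BN Bz.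
  have Nqq := qb_ge0 BN (submodB Bs Bq Bq').
  exists (x, q') => //=; split.
    have : N' q' <= k * (N' q + N' (q - q')).
      rewrite -[X in N' X](subKr q); apply: (qbB BN) => //; exact: submodB.
    have : N' (q - q') <= C * N' z by nra.
    move: k0; nra.
  have -> : z - (L x + q') = q - q' by rewrite zE [L x + q]addrC addrKA.
  apply: le_trans qq' _; rewrite -eC; nra.
exists x; split=> //; first by rewrite addrC addKr.
have := qb_ge0 QN Qq; move: xq; lra.
Qed.

(** Open mapping for [comb_map u] onto the preimage of [Q0]: the coordinates of [x] modulo [P0] are
    controlled by its norm. *)
Lemma basis0_bounded : exists2 C, 0 <= C & forall x, A x -> Q0 (L x) ->
  exists a p, [/\ P0 p, x = comb u a + p & row_norm a + N p <= C * N x].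
Proof.
have DN := qclosed_subspace_qbanach AN (preim_qclosed AN LAB L_lin M_ge0 L_bd Q0B).
have [C C0 bd] := comb_map_bounded Au P0A.
have [Q0s _ _] := Q0B; have [P0s P0A' _] := P0A.
have [||C' C'0 HC'] := open_mapping (comb_map_qbanach m P0A) DN _
  (@comb_map_linear m u P0) C0 bd.
- move=> [a p] [_ /= Pp]; have Ap := P0A' _ Pp.
  split; first exact: submodD (comb_in AN Au _) _.
  rewrite /comb_map/= (lin_onD L_lin)//; last exact: (comb_in AN Au).
  apply: submodD => //; last exact: LP0.
  by rewrite /comb (lin_on_comb As L_lin)//; exact: (submod_comb Q0s).
- move=> x [Ax Qx]; have [a [Pa _]] := basis0 Ax Qx.
  by exists (a, x - comb u a) => //; rewrite /comb_map/= addrC subrK.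
exists C' => // x Ax Qx.
have [[a p] [_ /= Pp] [<- ap]] := HC' x (conj Ax Qx).
by exists a, p.
Qed.

(** [L (u j)] lies in [Q0], hence within O(e') of [Q]; [surj_stable] solves for the defect with a
    correction of size O(e'), and f_j is u_j minus that correction. Keeping [e'] separate from the
    threshold [e] lets it be chosen after all constants are known. *)
Lemma basis_stable_approx : exists e C : R, [/\ 0 < e, 0 <= C &
  forall Q e', qclosed_subspace B N' Q -> 0 <= e' -> e' <= e ->
    almost_in N' e' Q0 Q ->
    (forall y, B y -> exists2 x, A x & Q (y - L x)) /\
    exists f : 'I_m -> E, forall j, [/\ A (f j), Q (L (f j)) & N (u j - f j) <= C * e']].
Proof.
have [e [C [e0 C0 HC]]] := surj_stable.
have [b b0 ub] := comb_bounded AN Au.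
exists e, (C * (M * b)); split => //; first by rewrite !mulr_ge0.
move=> Q e' Qcs e'0 e'e Q0Q; have [Qs QB _] := Qcs; have [_ Q0B' _] := Q0B.
have {HC} HC := HC Q Qcs (almost_in_le BN Q0B' e'e Q0Q); split.
  by move=> y /HC[x [Ax Qx _]]; exists x.
suff /choice[f fP] : forall j, exists x, [/\ A x, Q (L x) & N (u j - x) <= C * (M * b) * e'].
  by exists f.
move=> j; have [q Qq uq] := Q0Q _ (LQu j).
have Bq := QB _ Qq; have Bu := LAB (Au j).
have [x [Ax Qx Nx]] := HC _ (submodB Bs Bu Bq).
exists (u j - x); split; first exact: submodB.
  rewrite (lin_onB As L_lin)// -[L (u j)](subrK q) -addrA [q - _]addrC addrA.
  exact: submodD.
rewrite subKr; apply: le_trans Nx _; rewrite -mulrA ler_wpM2l//.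
apply: le_trans uq _; rewrite mulrC ler_wpM2r//.
by apply: le_trans (L_bd (Au j)) _; rewrite ler_wpM2l.
Qed.

Lemma small_enough (e1 c K : R) : 0 < e1 -> 0 < c -> 0 <= K ->
  exists e, [/\ 0 < e, e <= e1, e <= 1 & e * K <= c].
Proof.
move=> e1_gt0 c0 K0; have K1 : 0 < 1 + K by rewrite ltr_wpDr.
exists (Num.min (Num.min e1 1) (c / (1 + K))).
rewrite !lt_min !ge_min !lexx e1_gt0 ltr01 divr_gt0// orbT; split => //.
apply: (@le_trans _ _ (c / (1 + K) * K)).
  by rewrite ler_wpM2r// ge_min lexx orbT.
by rewrite mulrAC ler_pdivrMr// ler_wpM2l ?(ltW c0)// lerDr.
Qed.

(** Each one-sided gap has its task: [Q0] to [Q] perturbs the basis, [Q] to [Q0] and [P0] to [P]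
    give spanning modulo [P], and [P] to [P0] gives independence. *)
Theorem surjective_stable : exists2 e : R, 0 < e &
  forall P Q, qclosed_subspace A N P -> qclosed_subspace B N' Q ->
    (forall x, P x -> Q (L x)) ->
    almost_in N e P0 P -> almost_in N e P P0 ->
    almost_in N' e Q0 Q -> almost_in N' e Q Q0 ->
    (forall y, B y -> exists2 x, A x & Q (y - L x)) /\
    exists f : 'I_m -> E, (forall j, A (f j) /\ Q (L (f j))) /\
      forall x, A x -> Q (L x) -> exists! a, P (x - comb f a).
Proof.
have k0 := ltW k_gt0.
have [e1 [C3 [e1_gt0 C3_ge0 approx]]] := basis_stable_approx.
have [C1 C1_ge0 lift0] := modulo_surj_bounded AN BN LAB L_lin M_ge0 L_bd Q0B surj0.
have [C2 C2_ge0 rep0] := basis0_bounded.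
have [b b_ge0 ub] := comb_bounded AN Au.
pose Km := k ^+ m; have Km_ge0 : 0 <= Km by rewrite exprn_ge0.
(* [C4] bounds the coordinates used in one approximation of x, and e [C6] is the relative error of
   that approximation. [C7] bounds [comb f] in terms of its coefficients, and e [C8] bounds the
   distance of [comb u a] from [P0] relative to that of [a] from 0. *)
pose C4 := C2 * (k * (1 + C1 * M)).
have C4_ge0 : 0 <= C4 by rewrite !(mulr_ge0, addr_ge0).
pose C6 := k * (C1 * M + k * (C4 + Km * C3 * C4)).
have C6_ge0 : 0 <= C6 by rewrite !(mulr_ge0, addr_ge0).
pose C7 := Km * (k * (b + C3)).
have C7_ge0 : 0 <= C7 by rewrite !(mulr_ge0, addr_ge0).
pose C8 := k * (Km * C3 + C7).
have C8_ge0 : 0 <= C8 by rewrite !(mulr_ge0, addr_ge0).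
have c0 : 0 < (2 * k)^-1 by rewrite invr_gt0 mulr_gt0.
(* One condition on the sum covers two needs: e C6 <= 1/(2k) makes the approximation contract, and
   C2 e C8 <= 1/2 < 1 forces independence. *)
have [|e [e_gt0 ee1 e_le1 eK]] := small_enough e1_gt0 c0 (K := C6 + C2 * C8).
  by rewrite addr_ge0// mulr_ge0.
have e_ge0 := ltW e_gt0.
have eC6 : e * C6 <= (2 * k)^-1.
  by apply: le_trans eK; rewrite ler_wpM2l// lerDl mulr_ge0.
have eC8 : C2 * (e * C8) <= 2^-1.
  apply: (@le_trans _ _ (2 * k)^-1).
    by apply: le_trans eK; rewrite mulrCA ler_wpM2l// lerDr.
  by rewrite lef_pV2 ?posrE ?mulr_gt0// ler_peMr.
exists e => // P Q PA QB LP P0P PP0 Q0Q QQ0.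
have [surj [f fP]] := approx Q e QB e_ge0 ee1 Q0Q; split => //.
have Af j : A (f j) by have [] := fP j.
have LQf j : Q (L (f j)) by have [] := fP j.
have uf j : N (u j - f j) <= C3 * e by have [] := fP j.
have Auf j : A (u j - f j) by exact: submodB.
exists f; split=> // .
have PN := qclosed_subspace_qbanach AN PA.
have DN := qclosed_subspace_qbanach AN (preim_qclosed AN LAB L_lin M_ge0 L_bd QB).
have [Ps PA' _] := PA; have [P0s P0A' _] := P0A; have [Qs QB' _] := QB.
have [Q0s Q0B' _] := Q0B.
have LQcomb a : Q (L (comb f a)).
  by rewrite /comb (lin_on_comb As L_lin)//; exact: (submod_comb Qs).
have LQ0comb a : Q0 (L (comb u a)).
  by rewrite /comb (lin_on_comb As L_lin)//; exact: (submod_comb Q0s).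
(* Solve the problem at (P0, Q0) for L x moved into Q0, then move the solution
   back: the error is of order e, which approx_lift absorbs. *)
have exist x : A x -> Q (L x) -> exists a, P (x - comb f a).
  move=> Ax Qx; have [D D_ge0 bd] := comb_map_bounded Af PA.
  have [|||[a p] [_ /= Pp] [<- _]] := @approx_lift _ _ _ _ _ _ _ _ (comb_map f) D
    (comb_map_qbanach m PA) DN _ (@comb_map_linear m f P) D_ge0 bd
    (C4 + k * (2 * C4)) _ _ x (conj Ax Qx).
  - move=> [a p] [_ /= Pp]; have Ap := PA' _ Pp.
    split; first exact: submodD (comb_in AN Af _) _.
    rewrite /comb_map/= (lin_onD L_lin)//; last exact: (comb_in AN Af).
    by apply: submodD => //; exact: LP.
  - by rewrite !(mulr_ge0, addr_ge0).
  - move=> {}x [{}Ax {}Qx].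
    have BLx := LAB Ax; have Nx := qb_ge0 AN Ax.
    have [q0 Qq0 xq0] := QQ0 _ Qx; have Bq0 := Q0B' _ Qq0.
    have [x' [r [Ax' Q0r xr Nx']]] := lift0 _ (submodB Bs BLx Bq0).
    have Nx'_le : N x' <= C1 * (e * (M * N x)).
      apply: le_trans (le_trans _ Nx') _.
        by rewrite lerDl (qb_ge0 BN)//; exact: Q0B'.
      rewrite ler_wpM2l//; apply: le_trans xq0 _; rewrite ler_wpM2l//; exact: L_bd.
    have Axx' : A (x - x') by exact: submodB.
    have [|a [p0 [Pp0 xx' ap0]]] := rep0 _ Axx'.
      rewrite (lin_onB As L_lin)// -[L x](subrK q0) xr -[L x' + r + q0]addrA [L x' + _]addrC addrK.
      exact: submodD.
    have Ap0 := P0A' _ Pp0.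
    have Nxx' : N (x - x') <= k * (1 + C1 * M) * N x.
      apply: le_trans (qbB AN Ax Ax') _; rewrite -mulrA ler_wpM2l// mulrDl mul1r.
      rewrite lerD2l; apply: le_trans Nx'_le _; rewrite -mulrA ler_wpM2l//.
      by rewrite ler_piMl// mulr_ge0.
    have ap0C4 : row_norm a + N p0 <= C4 * N x.
      by apply: le_trans ap0 _; rewrite /C4 -mulrA ler_wpM2l.
    have a_ge0 := row_norm_ge0 a; have p0_ge0 := qb_ge0 AN Ap0.
    have [p Pp pp0] := P0P _ Pp0; have Ap := PA' _ Pp.
    have App : A (p0 - p) by exact: submodB.
    have pp0_ge0 := qb_ge0 AN App.
    have pp0_le : N (p0 - p) <= e * (C4 * N x).
      by apply: le_trans pp0 _; rewrite ler_wpM2l//; lra.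
    exists (a, p) => //=; split.
      have : N p <= k * (N p0 + N (p0 - p)).
        by rewrite -[X in N X](subKr p0); apply: (qbB AN).
      have : e * (C4 * N x) <= C4 * N x by rewrite ler_piMl// mulr_ge0.
      move: k0 ap0C4 a_ge0 p0_ge0 pp0_le; nra.
    (* The error has three sources: correcting [x] so that its image lies in [Q0], moving p0 into
       [P], and replacing [u] by [f]. They are the three summands of [C6]. *)
    have -> : x - comb_map f (a, p) = x' + ((p0 - p) + comb (fun j => u j - f j) a).
      rewrite comb_subr /comb_map/= -[X in X - _](subrK x') xx'.
      by rewrite [_ + x']addrC -addrA opprD addrACA [_ + (p0 - p)]addrC.
    have Acuf := comb_in AN Auf a.
    have cuf := comb_le AN Auf a uf.
    apply: le_trans (qbD AN Ax' (submodD As App Acuf)) _.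
    apply: (@le_trans _ _ (e * C6 * N x)); last by rewrite ler_wpM2r.
    have -> : e * C6 * N x = k * (C1 * (e * (M * N x)) +
        k * (e * (C4 * N x) + Km * (C3 * e) * (C4 * N x))) by rewrite /C6; ring.
    rewrite ler_wpM2l// lerD//; apply: le_trans (qbD AN App Acuf) _.
    rewrite ler_wpM2l// lerD//; apply: le_trans cuf _.
    by rewrite ler_wpM2l ?mulr_ge0//; lra.
  by exists a; rewrite /comb_map/= addrAC subrr add0r.
(* If comb f a is in P then comb u a is within O(e |a|) of P0, whereas its
   coordinates are controlled by that distance. *)
have uniq a : P (comb f a) -> a = 0.
  move=> Pa; have a_ge0 := row_norm_ge0 a.
  have fC7 : N (comb f a) <= C7 * row_norm a.
    apply: (comb_le AN Af) => j; rewrite -[X in N X](subKr (u j)).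
    apply: le_trans (qbB AN (Au j) (Auf j)) _; rewrite ler_wpM2l// lerD//.
    by apply: le_trans (uf j) _; rewrite ler_piMr.
  have [q P0q aq] := PP0 _ Pa; have Aq := P0A' _ P0q.
  have Aca := comb_in AN Af a; have Auca := comb_in AN Auf a.
  have uE : comb u a - q = comb (fun j => u j - f j) a + (comb f a - q).
    by rewrite comb_subr addrA subrK.
  have As' : A (comb u a - q) by apply: submodB => //; exact: (comb_in AN Au).
  have sC8 : N (comb u a - q) <= e * C8 * row_norm a.
    rewrite uE; apply: le_trans (qbD AN Auca (submodB As Aca Aq)) _.
    have -> : e * C8 * row_norm a =
      k * (Km * (C3 * e) * row_norm a + e * (C7 * row_norm a)) by rewrite /C8; ring.
    rewrite ler_wpM2l// lerD//; first exact: (comb_le AN Auf).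
    by apply: le_trans aq _; rewrite ler_wpM2l.
  have Qs' : Q0 (L (comb u a - q)).
    rewrite (lin_onB As L_lin)//; last exact: (comb_in AN Au).
    by apply: submodB => //; exact: LP0.
  have [a' [p' [P0p' sE ap']]] := rep0 _ As' Qs'.
  have [a0 [_ a0_uniq]] := basis0 As' Qs'.
  (* Both rows are coordinates of [comb u a - q] along [u] modulo [P0], so the bound on [a'] applies
     to [a]. *)
  have aa' : a = a'.
    have <- : a0 = a.
      by apply: a0_uniq; rewrite addrAC subrr add0r; exact: submodN.
    by apply: a0_uniq; rewrite sE addrAC subrr add0r.
  have a_le0 : row_norm a <= 0.
    have p'_ge0 := qb_ge0 AN (P0A' _ P0p').
    have : row_norm a <= C2 * (e * C8 * row_norm a).
      apply: (@le_trans _ _ (C2 * N (comb u a - q))); last by rewrite ler_wpM2l.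
      by apply: le_trans ap'; rewrite aa' lerDl.
    have : C2 * (e * C8) * row_norm a <= 2^-1 * row_norm a by rewrite ler_wpM2r.
    rewrite mulrA; lra.
  apply: (qb_eq0 (qbanach_row m k_ge1)) => //.
  by apply/eqP; rewrite eq_le a_le0 a_ge0.
move=> x Ax Qx; have [a Pa] := exist x Ax Qx; exists a; split=> // a' Pa'.
apply/eqP; rewrite -subr_eq0; apply/eqP/uniq; rewrite combB.
have -> : comb f a - comb f a' = (x - comb f a') - (x - comb f a).
  by rewrite opprB [RHS]addrC addrA subrK.
exact: submodB.
Qed.

End Stability.

(** * Dimensions of kernel and cokernel *)

Section Dimensions.
Context {R : realType}.

(** Expressing each basis in the other gives matrices; uniqueness of coordinates forces their
    product to be the identity, which bounds n by n'. *)
Lemma has_qdim_le (E : lmodType R[i]) (A B : set E) n n' :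
  submod_closed [in B] -> has_qdim A B n -> has_qdim A B n' -> (n <= n')%N.
Proof.
move=> Bs [e Ae eP] [e' Ae' e'P].
have /choice[C CP] : forall i, exists c, B (e i - comb e' c).
  by move=> i; have [c [Bc _]] := e'P _ (Ae i); exists c.
have /choice[D DP] : forall j, exists c, B (e' j - comb e c).
  by move=> j; have [c [Bc _]] := eP _ (Ae' j); exists c.
pose MC := \matrix_i C i; pose MD := \matrix_j D j.
suff : MC *m MD = 1%:M by exact: mulmx1_min.
apply/row_matrixP => i; have [c [_ c_uniq]] := eP _ (Ae i).
rewrite -(c_uniq (row i (MC *m MD))); last first.
  change (B (e i - comb e (row i (MC *m MD)))).
  rewrite row_mul comb_mulmx rowK.
  have -> : e i - comb (fun j => comb e (row j MD)) (C i) =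
      (e i - comb e' (C i)) + comb (fun j => e' j - comb e (row j MD)) (C i).
    by rewrite comb_subr addrA subrK.
  by apply: submodD => //; apply: (submod_comb Bs) => j; rewrite rowK.
apply: c_uniq; rewrite (bigD1 i)//= big1 => [|j ji]; last first.
  by rewrite !mxE eq_sym (negbTE ji) scale0r.
by rewrite !mxE eqxx scale1r addr0 subrr; exact: submod0.
Qed.

Lemma qdimE (E : lmodType R[i]) (A B : set E) n :
  submod_closed [in B] -> has_qdim A B n -> qdim A B = n.
Proof.
move=> Bs ABn; have : has_qdim A B (qdim A B).
  by rewrite /qdim; case: xgetP => // /(_ n).
move=> h; apply/eqP.
by rewrite eqn_leq (has_qdim_le Bs h ABn) (has_qdim_le Bs ABn h).
Qed.

Lemma submod_set0 (E : lmodType R[i]) : submod_closed [in [set (0 : E)]].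
Proof. by apply/submodP; split=> // a x y -> ->; rewrite scaler0 addr0. Qed.

(** * Kernel and cokernel read off the matrix of an augmented surjection *)

Section FredholmMatrix.
Context {E E' : lmodType R[i]}.
Variables (X : set E) (Y : set E') (t : E -> E') (m n : nat).
Variables (f : 'I_m -> E) (v : 'I_n -> E') (C : 'M[R[i]]_(m, n)).
Hypotheses (Xs : submod_closed [in X]) (Ys : submod_closed [in Y]).
Hypotheses (t_lin : linear_on X t) (Xf : forall j, X (f j)) (Yv : forall i, Y (v i)).
Hypothesis t_spans : forall y, Y y -> exists x c, X x /\ y = t x + comb v c.
Hypothesis tf : forall j, t (f j) + comb v (row j C) = 0.
Hypothesis f_basis : forall x c, X x -> t x + comb v c = 0 ->
  exists! a, x = comb f a /\ c = a *m C.

Lemma range_submod : submod_closed [in range_on X t].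
Proof.
apply/submodP; split; first by exists 0; [exact: submod0|exact: lin_on0 Xs t_lin].
move=> a _ _ [x Xx <-] [y Xy <-]; exists (a *: x + y); first exact: submodZD.
exact: t_lin.
Qed.

Lemma t_comb a : t (comb f a) = - comb v (a *m C).
Proof.
rewrite /comb (lin_on_comb Xs t_lin)// -/(comb _ _) comb_mulmx.
apply/eqP; rewrite -subr_eq0 opprK /comb -big_split/= big1// => j _.
by rewrite -scalerDr tf scaler0.
Qed.

(** Pairs (x, 0) in the kernel of (x, c) |-> t x + comb v c are the combinations with coefficients
    [a] such that a C = 0, and this space of rows has dimension m - rank C. *)
Lemma has_qdim_ker : has_qdim (ker_on X t) [set 0] (m - \rank C).
Proof.
rewrite -mxrank_ker; pose K := row_base (kermx C).
have KC : K *m C = 0 by apply/sub_kermxP; rewrite eq_row_base.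
exists (fun l => comb f (row l K)).
  move=> l; split; first exact: (submod_comb Xs).
  by rewrite t_comb -row_mul KC row0 comb0 oppr0.
move=> x [Xx tx0].
have [|a [[xa a0] a_uniq]] := f_basis (c := 0) Xx; first by rewrite tx0 comb0 addr0.
have /submxP[c ac] : (a <= K)%MS by rewrite eq_row_base; apply/sub_kermxP.
exists c; split.
  by change (x - comb (fun l => comb f (row l K)) c = 0); rewrite -comb_mulmx -ac xa subrr.
move=> c' /subr0_eq; rewrite -/(comb _ _) -comb_mulmx => xc'.
apply: (row_free_inj (row_base_free (kermx C))); rewrite -/K -ac.
by apply: a_uniq; split=> //; rewrite -mulmxA KC mulmx0.
Qed.

(** Modulo the range every y is some [comb v c], and [comb v c] is in the range exactly when c is in
    the row space of [C]. A basis of a complement of the row space therefore gives one of the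
    cokernel. *)
Lemma has_qdim_coker : has_qdim Y (range_on X t) (n - \rank C).
Proof.
rewrite -mxrank_compl; pose K := row_base (C^C)%MS.
have KE : (K :=: C^C)%MS by exact: eq_row_base.
pose e l := comb v (row l K).
exists e; first by move=> l; exact: (submod_comb Ys).
move=> y Yy; have [x [c [Xx yE]]] := t_spans Yy.
have /sub_addsmxP[[s b'] /= cE] : (c <= C + C^C)%MS.
  by apply: submx_full; exact: addsmx_compl_full.
have /submxP[b bE] : (b' *m C^C <= K)%MS by rewrite KE submxMl.
have [x0 Xx0 tx0] : range_on X t (y - comb e b).
  rewrite -comb_mulmx; exists (x - comb f s).
    by apply: submodB => //; exact: (submod_comb Xs).
  rewrite (lin_onB Xs t_lin)//; last exact: (submod_comb Xs).
  by rewrite t_comb opprK yE cE bE combD addrA addrK.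
exists b; split; first by exists x0.
move=> d [x' Xx' tx'].
have [|a [[_ aE] _]] := f_basis (x := x0 - x') (c := (b - d) *m K) (submodB Xs Xx0 Xx').
  rewrite (lin_onB Xs t_lin)// tx0 tx' comb_mulmx -/(comb e _) combB.
  have -> : (y - comb e b) - (y - comb e d) = comb e d - comb e b.
    by rewrite opprB [LHS]addrC addrA subrK.
  by rewrite addrA subrK subrr.
(* This row lies in the row space of [C] and in its complement. *)
have : (b - d) *m K = 0.
  apply/eqP; rewrite -submx0 -(capmx_compl C) sub_capmx aE submxMl /= -aE.
  by apply: submx_trans (submxMl _ _) _; rewrite eq_row_base.
move/eqP; rewrite mulmx_free_eq0 ?row_base_free// subr_eq0 => /eqP //.
Qed.

End FredholmMatrix.

End Dimensions.

(** * Finite dimensional augmentation *)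

Section Augmentation.
Context {R : realType} {E E' : lmodType R[i]} (k : R).
Variables (A : set E) (N : E -> R) (B : set E') (N' : E' -> R) (L : E -> E') (M : R).
Hypotheses (AN : qbanach k A N) (BN : qbanach k B N').
Hypotheses (LAB : forall x, A x -> B (L x)) (L_lin : linear_on A L).
Hypotheses (M_ge0 : 0 <= M) (L_bd : forall x, A x -> N' (L x) <= M * N x).
Variables (n : nat) (v : 'I_n -> E').
Hypothesis Bv : forall i, B (v i).

Let A' : set (E * 'rV[R[i]]_n) := A `*` setT.
Let NA' (p : E * 'rV[R[i]]_n) := N p.1 + row_norm p.2.

Definition augment (p : E * 'rV[R[i]]_n) := L p.1 + comb v p.2.

Lemma augment_in p : A' p -> B (augment p).
Proof.
by move=> [Ax _]; apply: (submodD (qb_sub BN)); [exact: LAB|exact: (comb_in BN)].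
Qed.

Lemma augment_linear : linear_on A' augment.
Proof.
move=> a [x c] [x' c'] [/= Ax _] [/= Ax' _].
by rewrite /augment/= L_lin// comb_linear scalerDr addrACA.
Qed.

Lemma augment_bounded : exists2 C, 0 <= C &
  forall p, A' p -> N' (augment p) <= C * NA' p.
Proof.
have [b b0 vb] := comb_bounded BN Bv.
have k0 : 0 <= k by apply: le_trans (qb_ge1 AN).
have kb : 0 <= k ^+ n * b by rewrite mulr_ge0// exprn_ge0.
exists (k * (M + k ^+ n * b)); first by rewrite mulr_ge0// addr_ge0.
move=> [x c] [/= Ax _]; apply: le_trans (qbD BN (LAB Ax) (comb_in BN Bv c)) _.
rewrite -mulrA ler_wpM2l//= /NA'/=.
apply: le_trans (lerD (L_bd Ax) (comb_le BN Bv c vb)) _.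
have Mc : 0 <= M * row_norm c by rewrite mulr_ge0// row_norm_ge0.
have bx : 0 <= k ^+ n * b * N x by rewrite mulr_ge0// (qb_ge0 AN).
by rewrite mulrDl !mulrDr; lra.
Qed.

Lemma augment_qbanach : qbanach k A' NA'.
Proof. exact: qbanach_prod AN (qbanach_row n (qb_ge1 AN)). Qed.

(** The subspace is paired with [[set 0]], so that the row [c] is determined by the class of (x, c);
    the matrix C_z is later read from it. *)
Lemma augment_qclosed P : qclosed_subspace A N P ->
  qclosed_subspace A' NA' (P `*` [set 0]).
Proof.
move=> [Ps PA Pc]; split.
- apply/submodP; split; first by split=> //; exact: submod0 Ps.
  move=> a [x c] [x' c'] [/= Px ->] [/= Px' ->].
  by split; [exact: submodZD|rewrite /= scaler0 addr0].
- by move=> [x c] [/= /PA Ax _].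
move=> [x c] [/= Ax _] H; split=> /=.
  apply: Pc => // e e0; have [[x' c'] [/= Px' _] xx'] := H e e0.
  exists x' => //; apply: le_lt_trans xx'; rewrite /NA'/=.
  by rewrite lerDl row_norm_ge0.
apply: (qb_eq0 (qbanach_row n (qb_ge1 AN))) => //.
apply/eqP; rewrite eq_le row_norm_ge0 andbT; apply/ler_addgt0Pl => e e0.
rewrite addr0; have [[x' c'] [/= Px' ->] xx'] := H e e0.
apply: ltW; apply: le_lt_trans xx'; rewrite /NA'/= subr0 lerDr (qb_ge0 AN)//.
by apply: (submodB (qb_sub AN)) => //; exact: PA.
Qed.

Lemma augment_almost_in e P Q : almost_in N e P Q ->
  almost_in NA' e (P `*` [set 0]) (Q `*` [set 0]).
Proof.
move=> PQ [x c] [/= Px ->]; have [q Qq xq] := PQ x Px.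
exists (q, 0) => //; rewrite /NA'/= subr0.
have -> : row_norm (0 : 'rV[R[i]]_n) = 0.
  by rewrite (qb0 (qbanach_row n (qb_ge1 AN))).
by rewrite !addr0.
Qed.

(** Finite codimension forces closed range: the coordinates of a class modulo the range are unique
    by [free] and bounded by open mapping, hence vanish on the closure. With [Q] the kernel of an
    evaluation, the assumption on [y] is membership in the closure of the induced range, with
    representatives in place of the infimum norm. *)
Lemma range_modulo_closed Q : qclosed_subspace B N' Q ->
  (forall y, B y -> exists x c, A x /\ Q (y - (L x + comb v c))) ->
  (forall x c, A x -> Q (comb v c - L x) -> c = 0) ->
  forall y, B y ->
    (forall e, 0 < e -> exists x z, [/\ A x, B z, Q (y - z - L x) & N' z < e]) ->
    exists2 x, A x & Q (y - L x).
Proof.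
move=> QB spans free y By H; have [Qs QB' _] := QB; have As := qb_sub AN.
have [K K0 bd] := augment_bounded.
have [|C C0 HC] := modulo_surj_bounded augment_qbanach BN augment_in augment_linear K0 bd QB.
  by move=> y' /spans[x [c [Ax Qx]]]; exists (x, c).
have HC' z : B z -> exists x c q, [/\ A x, Q q, z = L x + comb v c + q &
    row_norm c <= C * N' z].
  move=> Bz; have [[x c] [q [[/= Ax _] Qq zE]]] := HC z Bz.
  rewrite /NA'/= => xcq; exists x, c, q; split=> //; apply: le_trans xcq.
  by rewrite addrAC lerDr addr_ge0// ?(qb_ge0 AN)// (qb_ge0 BN)//; exact: QB'.
have [x [c [q [Ax Qq yE _]]]] := HC' y By.
(* The open mapping theorem bounds the coordinates c of y modulo the range by
   those of the arbitrarily small z. *)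
suff c0 : c = 0.
  by exists x => //; rewrite yE c0 comb0 addr0 addrAC subrr add0r.
apply: (qb_eq0 (qbanach_row n (qb_ge1 AN))) => //.
apply/eqP; rewrite eq_le row_norm_ge0 andbT; apply/ler_addgt0Pl => e e0.
have e1 : 0 < e / (C + 1) by rewrite divr_gt0// ltr_wpDl.
rewrite addr0; have [x2 [z [Ax2 Bz Qz zN]]] := H _ e1.
have [x1 [c1 [q1 [Ax1 Qq1 zE c1N]]]] := HC' z Bz.
have cc1 : c = c1.
  apply/eqP; rewrite -subr_eq0; apply/eqP; apply: (free (x2 + x1 - x)).
    by apply: submodB => //; exact: submodD.
  have -> : comb v (c - c1) - L (x2 + x1 - x) = (y - z - L x2) - (q - q1).
    rewrite yE zE (lin_onB As L_lin)// ?(lin_onD L_lin)//; last exact: submodD.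
    rewrite [- (_ + q1)]opprD [_ + q + _]addrACA [_ - L x2]addrAC addrK combB.
    rewrite [- (L x1 + _)]opprD [L x + _ + _]addrACA [_ + (comb v c - _)]addrC.
    by rewrite -[RHS]addrA; congr (_ + _); rewrite opprB opprD addrA addrAC.
  by do 2![apply: (submodB Qs) => //].
rewrite cc1; apply: le_trans c1N _.
move: zN; rewrite ltr_pdivlMr ?ltr_wpDl// => zN.
have := qb_ge0 BN Bz; move: C0 zN; nra.
Qed.

End Augmentation.

(** * Interpolation scales *)

Section Evaluation.
Context {R : realType} {U : topologicalType} (delta : U -> U -> R[i]^o).
Context {Z : topologicalLmodType R[i]}.
Variables (F : set (U -> Z)) (NF : (U -> Z) -> R).
Hypotheses (FA : admissible delta F NF) (Z_hausdorff : hausdorff_space Z).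

(** Every large constant is allowed, so that two families can share one. *)
Lemma admissible_qbanach : exists k0, forall k, k0 <= k -> qbanach k F NF.
Proof.
have [Fs [N0 Neq0 NZ [kappa ND] _] Fc _ _] := FA.
exists (Num.max 1 kappa) => k; rewrite ge_max => /andP[k1 kk]; split => //.
move=> x y Fx Fy; apply: le_trans (ND x y Fx Fy) _.
by rewrite ler_wpM2r// addr_ge0// N0.
Qed.

Definition vanishing z : set (U -> Z) := [set f | F f /\ f z = 0].

(** By continuity of evaluation every neighbourhood of [f z] contains some g z = 0, and [Z] is
    Hausdorff. *)
Lemma vanishing_qclosed z : qclosed_subspace F NF (vanishing z).
Proof.
have Fs := adm_submod FA; split.
- apply/submodP; split; first by split=> //; exact: submod0.
  move=> a f g [Ff f0] [Fg g0]; split; first exact: submodZD.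
  have -> : (a *: f + g) z = a *: f z + g z by [].
  by rewrite f0 g0 scaler0 addr0.
- by move=> f [].
move=> f Ff H; split=> //; apply: Z_hausdorff => V V' fV V'0.
have [d d0 dV] := adm_eval FA Ff fV.
have [g [Fg g0] fg] := H d d0.
exists 0; split; last exact: nbhs_singleton.
rewrite -g0; apply: dV => //.
have [k0 FN] := admissible_qbanach.
by rewrite (qbBC (FN _ (lexx _))).
Qed.

Hypotheses (delta_eq0 : forall z w : U, delta z w = 0 <-> z = w).

Lemma vanishing_almost_in (K : set U) : compact K -> exists2 D, 0 < D &
  forall z w, K w -> almost_in NF (modulus (delta z w) * D) (vanishing w) (vanishing z).
Proof.
move=> cK; have Fs := adm_submod FA; have [D D0 HD] := adm_div FA cK.
exists D => // z w Kw f [Ff fw]; have [g [Fg gf gD]] := HD w f Kw Ff fw.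
exists (f - delta z w *: g).
  split; first by apply: submodB => //; exact: submodZ.
  have -> : (f - delta z w *: g) z = f z - delta z w *: g z by [].
  (* At z = w the value of g is not given by the quotient, but there the coefficient [delta w w] is
     0. *)
  have [->|zw] := pselect (z = w).
    by rewrite fw (delta_eq0 w w).2// scale0r subr0.
  rewrite gf// scalerA divff ?scale1r ?subrr//.
  by apply/eqP => /delta_eq0.
rewrite subKr; have [k0 FN] := admissible_qbanach.
by rewrite (qbZ (FN _ (lexx _)))// -mulrA ler_wpM2l// modulus_ge0.
Qed.

Hypothesis delta_continuous : continuous (fun p : U * U => delta p.1 p.2).

(** Both orders of the arguments are needed because [delta] need not be symmetric. *)
Lemma modulus_delta_small (w : U) (e : R) : 0 < e ->
  \forall z \near w, modulus (delta z w) < e /\ modulus (delta w z) < e.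
Proof.
move=> e0; have eC : 0 < (e%:C)%C :> R[i] by rewrite ltcE/= eqxx.
have small (h : U -> U * U) : h w = (w, w) -> {for w, continuous h} ->
    \forall z \near w, modulus (delta (h z).1 (h z).2) < e.
  move=> hw hc.
  have : delta (h z).1 (h z).2 @[z --> w] --> delta (h w).1 (h w).2.
    exact: (cvg_comp h (fun p : U * U => delta p.1 p.2) hc (@delta_continuous (h w))).
  rewrite hw (delta_eq0 w w).2// => /cvgr0Pnorm_lt/(_ _ eC); apply: filterS => z.
  by rewrite ltcE => /andP[_].
near=> z; split; near: z.
  by apply: (small (fun z => (z, w))) => //; apply: cvg_pair => //; exact: cvg_cst.
by apply: (small (fun z => (w, z))) => //; apply: cvg_pair => //; exact: cvg_cst.
Unshelve. all: by end_near.
Qed.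

Hypothesis U_locally_compact : locally_compact [set: U].

(** One of the two inclusions divides at the moving point z, so the division constant must be
    uniform near [w]; local compactness provides a compact neighbourhood on which it is. *)
Lemma vanishing_gap (w : U) (e : R) : 0 < e -> \forall z \near w,
  almost_in NF e (vanishing w) (vanishing z) /\
  almost_in NF e (vanishing z) (vanishing w).
Proof.
move=> e0; have [K wK [cK _]] := @U_locally_compact w I.
have {}wK : nbhs w K by move: wK; rewrite /within /=; apply: filterS => x; apply.
have [D D0 HD] := vanishing_almost_in cK.
have eD : 0 < e / D by rewrite divr_gt0.
have [k0 FN] := admissible_qbanach; have {}FN := FN _ (lexx k0).
have incl z : vanishing z `<=` F by move=> f [].
have small := modulus_delta_small w eD.
near=> z.
have [zw wz] : modulus (delta z w) < e / D /\ modulus (delta w z) < e / D by near: z.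
have Kz : K z by near: z.
split.
  apply: (almost_in_le FN (@incl w) _ (HD z w _)); last exact: nbhs_singleton.
  by rewrite -ler_pdivlMr// ltW.
apply: (almost_in_le FN (@incl z) _ (HD w z _)) => //.
by rewrite -ler_pdivlMr// ltW.
Unshelve. all: by end_near.
Qed.

End Evaluation.

(** * Operators between two scales *)

Section Interpolation.
Context {R : realType} {U : topologicalType} (delta : U -> U -> R[i]^o).
Context {Z W : topologicalLmodType R[i]}.
Variables (F : set (U -> Z)) (NF : (U -> Z) -> R).
Variables (G : set (U -> W)) (NG : (U -> W) -> R).
Variable T : U -> Z -> W.
Hypotheses (delta_eq0 : forall z w : U, delta z w = 0 <-> z = w).
Hypothesis delta_continuous : continuous (fun p : U * U => delta p.1 p.2).
Hypothesis U_locally_compact : locally_compact [set: U].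
Hypotheses (Z_hausdorff : hausdorff_space Z) (W_hausdorff : hausdorff_space W).
Hypotheses (FA : admissible delta F NF) (GA : admissible delta G NG).
Hypothesis TI : interpolating_family F NF G NG T.

Let Fs := adm_submod FA.
Let Gs := adm_submod GA.

Definition lift_op (f : U -> Z) : U -> W := fun z => T z (f z).

Lemma comb_app (V : lmodType R[i]) n (f : 'I_n -> U -> V) c z :
  comb f c z = comb (fun j => f j z) c.
Proof. by rewrite /comb fct_sumE. Qed.

Lemma lift_in f : F f -> G (lift_op f).
Proof. by have [H _ _] := TI; exact: H. Qed.

Lemma lift_linear : linear_on F lift_op.
Proof. by have [_ H _] := TI; exact: H. Qed.

Lemma inter_space_submod (V : topologicalLmodType R[i]) (H : set (U -> V)) z :
  submod_closed [in H] -> submod_closed [in inter_space H z].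
Proof.
move=> Hs; apply/submodP; split; first by exists 0 => //; exact: submod0.
by move=> a _ _ [f Hf <-] [g Hg <-]; exists (a *: f + g) => //; exact: submodZD.
Qed.

Lemma T_linear z : linear_on (inter_space F z) (T z).
Proof.
move=> a _ _ [f Ff <-] [g Fg <-].
exact: (congr1 (fun h => h z) (lift_linear a Ff Fg)).
Qed.

Lemma inter_norm_le (V : topologicalLmodType R[i]) (H : set (U -> V)) NH z f :
  (forall g, H g -> 0 <= NH g) -> H f -> inter_norm H NH z (f z) <= NH f.
Proof.
move=> NH0 Hf; apply: ge_inf; last by exists f.
by exists 0 => _ [g [Hg _] <-]; exact: NH0.
Qed.

Lemma T_bounded_linear z : bounded_linear_on (inter_space F z) (inter_norm F NF z)
  (inter_space G z) (inter_norm G NG z) (T z).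
Proof.
split; [|exact: T_linear|].
  by move=> _ [f Ff <-]; exists (lift_op f) => //; exact: lift_in.
have [_ _ [M M0 HM]] := TI; exists M => x [f0 Ff0 f0x].
rewrite -ler_pdivrMl//; apply: lb_le_inf; first by exists (NF f0), f0.
move=> _ [f [Ff <-] <-]; rewrite ler_pdivrMl//.
apply: le_trans (HM f Ff).
have NG0 := qnorm_ge0 (adm_qnorm GA).
exact: (inter_norm_le z NG0 (lift_in Ff)).
Qed.

Lemma common_qbanach : exists k, qbanach k F NF /\ qbanach k G NG.
Proof.
have [kF FNk] := admissible_qbanach FA; have [kG GNk] := admissible_qbanach GA.
exists (Num.max kF kG).
by split; [apply: FNk|apply: GNk]; rewrite le_max lexx ?orbT.
Qed.

Lemma has_qdim_lift (V : topologicalLmodType R[i]) (H : set (U -> V)) z (I : Type)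
    (e : I -> V) :
  (forall i, inter_space H z (e i)) ->
  exists h : I -> U -> V, (forall i, H (h i)) /\ (fun i => h i z) = e.
Proof.
move=> He; have /choice[h hP] : forall i, exists g, H g /\ g z = e i.
  by move=> i; have [g Hg gz] := He i; exists g.
by exists h; split=> [i|]; [have [] := hP i|apply/funext => i; have [] := hP i].
Qed.

Lemma range_at_closed z d :
  has_qdim (inter_space G z) (range_at F T z) d ->
  qclosed (inter_space G z) (inter_norm G NG z) (range_at F T z).
Proof.
move=> [e Ge eP] _ [g Gg <-] H; have [k [FN GN]] := common_qbanach.
have [v [Gv vz]] := has_qdim_lift Ge.
have [_ _ [M /ltW M0 HM]] := TI.
have range_sub := range_submod (inter_space_submod z Fs) (@T_linear z).
have [|||f Ff [_]] := range_modulo_closed FN GN lift_in lift_linear M0 HM Gv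
    (vanishing_qclosed GA W_hausdorff z) _ _ Gg.
- move=> h Gh; have [|c [[x [f Ff fz] Tx] _]] := eP (h z); first by exists h.
  exists f, c; split=> //; split.
    apply: (submodB Gs) => //; apply: (submodD Gs); first exact: lift_in.
    exact: (comb_in GN).
  have -> : (h - (lift_op f + comb v c)) z = h z - (T z (f z) + comb v c z) by [].
  by rewrite comb_app vz fz Tx subrK subrr.
- move=> f c Ff [_].
  have -> : (comb v c - lift_op f) z = comb v c z - T z (f z) by [].
  rewrite comb_app vz => /subr0_eq ec.
  have [|c0 [_ c0_uniq]] := eP 0; first exact: submod0 (inter_space_submod z Gs).
  have <- : c0 = c.
    apply: c0_uniq; rewrite -/(comb e c) ec sub0r; apply: (submodN range_sub).
    by exists (f z) => //; exists f.
  apply: c0_uniq; rewrite -/(comb e 0) comb0 subr0; exact: submod0 range_sub.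
(* An infimum norm below [eps] is witnessed by a representative h in [G] of norm below [eps]. *)
- move=> eps /H[_ [_ [f Ff <-] <-]] /inf_lt[|_ [h [Gh hz] <-] hN].
    exists (NG (g - lift_op f)), (g - lift_op f) => //; split=> //.
    by apply: (submodB Gs) => //; exact: lift_in.
  exists f, h; split=> //; split.
    by apply: (submodB Gs); [exact: (submodB Gs)|exact: lift_in].
  have -> : (g - h - lift_op f) z = g z - h z - T z (f z) by [].
  by rewrite hz subKr subrr.
have -> : (g - lift_op f) z = g z - T z (f z) by [].
by move=> /subr0_eq ->; exists (f z) => //; exists f.
Qed.

Lemma fredholm_near w m n :
  has_qdim (ker_at F T w) [set 0] m ->
  has_qdim (inter_space G w) (range_at F T w) n ->
  \forall z \near w, fredholm_at F NF G NG T z /\ exists r, [/\ (r <= m)%N, (r <= n)%N,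
    has_qdim (ker_at F T z) [set 0] (m - r) &
    has_qdim (inter_space G z) (range_at F T z) (n - r)].
Proof.
move=> [ek kerk kP] [ec Gc cP].
have [u [Fu uw]] : exists u : 'I_m -> U -> Z, (forall j, F (u j)) /\ (fun j => u j w) = ek.
  by apply: has_qdim_lift => j; have [] := kerk j.
have [v [Gv vw]] := has_qdim_lift Gc.
have [k [FN GN]] := common_qbanach.
have [_ _ [M /ltW M0 HM]] := TI.
have lin := lift_linear.
pose L := augment lift_op v.
pose A' := F `*` [set: 'rV[R[i]]_n].
pose NA' (p : (U -> Z) * 'rV[R[i]]_n) := NF p.1 + row_norm p.2.
have AN' : qbanach k A' NA' by exact: augment_qbanach.
have LA' p : A' p -> G (L p) by exact: (augment_in GN lift_in Gv).
have L_lin : linear_on A' L by exact: augment_linear.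
have [K K0 LK] := augment_bounded FN GN lift_in M0 HM Gv.
pose P z := vanishing F z `*` [set (0 : 'rV[R[i]]_n)].
pose Q z := vanishing G z.
have PA z : qclosed_subspace A' NA' (P z).
  refine (augment_qclosed FN n (vanishing_qclosed FA Z_hausdorff z)).
have QG z : qclosed_subspace G NG (Q z) := vanishing_qclosed GA W_hausdorff z.
have T0 z : T z 0 = 0 by exact: (lin_on0 (inter_space_submod z Fs) (@T_linear z)).
have LE p z : L p z = T z (p.1 z) + comb (fun i => v i z) p.2.
  by rewrite -comb_app.
have LPQ z p : P z p -> Q z (L p).
  move=> [[Fp pz] p2]; split; first exact: LA'.
  by rewrite LE pz p2 T0 comb0 addr0.
(* At [w] the kernel of the augmented map has no row part, as [ec] is independent modulo the range;
   lifts of a basis of Ker T_w, paired with 0, thus form its basis. *)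
pose uh j : (U -> Z) * 'rV[R[i]]_n := (u j, 0).
have comb_pair l (h : 'I_l -> (U -> Z) * 'rV[R[i]]_n) a :
    comb h a = (comb (fun j => (h j).1) a, comb (fun j => (h j).2) a).
  rewrite /comb; apply: (big_rec3 (fun x y z => z = (x, y))) => //=.
  by move=> i x y z _ ->.
have [||||e e0 stable] := surjective_stable AN' GN LA' L_lin K0 LK (PA w) (QG w) (@LPQ w)
    (u := uh).
- by move=> j; split; [exact: Fu|].
- move=> j; split; first by apply: LA'; split; [exact: Fu|].
  rewrite LE /= comb0 addr0 -[u j w]/((fun j => u j w) j) uw.
  by have [] := kerk j.
- move=> g Gg; have [|c [[x [f Ff fw] Tx] _]] := cP (g w); first by exists g.
  exists (f, c); first by split.
  split; first by apply: (submodB Gs) => //; apply: LA'; split.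
  have -> : (g - L (f, c)) w = g w - L (f, c) w by [].
  by rewrite LE /= fw Tx vw subrK subrr.
- move=> [f c] [/= Ff _] [_]; rewrite LE /= vw => Tfc.
  have range_sub := range_submod (inter_space_submod w Fs) (@T_linear w).
  have c0 : c = 0.
    have [|c0 [_ c0_uniq]] := cP 0; first exact: submod0 (inter_space_submod w Gs).
    have <- : c0 = c.
      apply: c0_uniq; exists (f w); first by exists f.
      by apply/eqP; rewrite -/(comb ec c) sub0r -addr_eq0 Tfc.
    apply: c0_uniq; rewrite -/(comb ec 0) comb0 subr0; exact: submod0 range_sub.
  rewrite c0 comb0 addr0 in Tfc *.
  have PE a : P w ((f, 0) - comb uh a) <-> f w - comb ek a = 0.
    rewrite comb_pair -uw -comb_app; split; first by case=> -[_ fa _].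
    move=> fa; split; last by rewrite /= /comb big1 ?subrr// => i _; rewrite scaler0.
    by split=> //=; apply: (submodB Fs) => //; exact: (comb_in FN).
  have [|a [fa a_uniq]] := kP (f w); first by split=> //; exists f.
  exists a; split; first exact/PE.
  by move=> a' /PE fa'; exact: a_uniq.
near=> z.
have [gF gF'] : almost_in NF e (vanishing F w) (vanishing F z) /\
    almost_in NF e (vanishing F z) (vanishing F w).
  by near: z; exact: (vanishing_gap FA delta_eq0 delta_continuous U_locally_compact).
have [gG gG'] : almost_in NG e (vanishing G w) (vanishing G z) /\
    almost_in NG e (vanishing G z) (vanishing G w).
  by near: z; exact: (vanishing_gap GA delta_eq0 delta_continuous U_locally_compact).
have [surj [fh [Afh fh_basis]]] := stable _ _ (PA z) (QG z) (@LPQ z)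
  (augment_almost_in FN gF) (augment_almost_in FN gF') gG gG'.
(* The perturbed basis elements at z may have nonzero row parts; these rows measure how far the
   kernel and cokernel shrink. *)
pose C : 'M[R[i]]_(m, n) := \matrix_j (fh j).2.
pose fz j := (fh j).1 z; pose vz i := v i z.
have Xs := inter_space_submod z Fs; have Ys := inter_space_submod z Gs.
have Xf j : inter_space F z (fz j).
  by have [[Ff _] _] := Afh j; exists (fh j).1.
have Yv i : inter_space G z (vz i) by exists (v i).
have t_spans y : inter_space G z y ->
    exists x c, inter_space F z x /\ y = T z x + comb vz c.
  move=> [g Gg <-]; have [[f c] [/= Ff _] [_]] := surj g Gg.
  have -> : (g - L (f, c)) z = g z - L (f, c) z by [].
  by rewrite LE => /subr0_eq gz; exists (f z), c; split=> //; exists f.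
have tf j : T z (fz j) + comb vz (row j C) = 0.
  by have [_ [_]] := Afh j; rewrite LE rowK.
have f_basis x c : inter_space F z x -> T z x + comb vz c = 0 ->
    exists! a, x = comb fz a /\ c = a *m C.
  move=> [f Ff <-] Tfc.
  have PE a : P z ((f, c) - comb fh a) <-> f z = comb fz a /\ c = a *m C.
    have -> : a *m C = comb (fun j => (fh j).2) a.
      by rewrite mulmx_sum_row; apply: eq_bigr => i _; rewrite rowK.
    rewrite comb_pair -(comb_app (fun j => (fh j).1)); split.
      by case=> -[_ /subr0_eq ? /subr0_eq].
    move=> [fa ca]; split; last by rewrite /= ca subrr.
    split=> /=; last by apply/eqP; rewrite subr_eq0; apply/eqP.
    by apply: (submodB Fs) => //; apply: (comb_in FN) => j; have [[]] := Afh j.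
  have [||a [fa a_uniq]] := fh_basis (f, c); first by split.
    by split; [exact: LA'|rewrite LE].
  exists a; split; first exact/PE.
  by move=> a' /PE fa'; exact: a_uniq.
have kd := has_qdim_ker Xs (@T_linear z) Xf tf f_basis.
have cd := has_qdim_coker Xs Ys (@T_linear z) Xf Yv t_spans tf f_basis.
split; last by exists (\rank C); rewrite rank_leq_row rank_leq_col.
split; first exact: T_bounded_linear.
- by exists (m - \rank C)%N.
- exact: range_at_closed cd.
- by exists (n - \rank C)%N.
Unshelve. all: by end_near.
Qed.

End Interpolation.

Theorem theorem2p9 (R : realType) (U : topologicalType)
  (delta : U -> U -> R[i]^o) (Z W : topologicalLmodType R[i])
  (F : set (U -> Z)) (NF : (U -> Z) -> R)
  (G : set (U -> W)) (NG : (U -> W) -> R)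
  (T : U -> Z -> W)
  (U_hausdorff : hausdorff_space U)
  (U_locally_compact : locally_compact [set: U])
  (U_locally_connected : locally_connected U)
  (delta_continuous : continuous (fun p : U * U => delta p.1 p.2))
  (delta_eq0 : forall z w : U, delta z w = 0 <-> z = w)
  (Z_hausdorff : hausdorff_space Z)
  (W_hausdorff : hausdorff_space W)
  (F_admissible : admissible delta F NF)
  (G_admissible : admissible delta G NG)
  (T_interpolating : interpolating_family F NF G NG T)
  (G_intersection : intersection_property G NG) :
  [/\ open [set z : U | fredholm_at F NF G NG T z],
      forall w : U, fredholm_at F NF G NG T w ->
        \forall z \near w, fredholm_at F NF G NG T z ->
          index_at F G T z = index_at F G T w
    & forall w : U, fredholm_at F NF G NG T w ->
        \forall z \near w,
          [/\ finite_qdim (ker_at F T z) [set 0],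
              (qdim (ker_at F T z) [set 0%R] <= qdim (ker_at F T w) [set 0%R])%N,
              finite_qdim (inter_space G z) (range_at F T z)
            & (qdim (inter_space G z) (range_at F T z)
               <= qdim (inter_space G w) (range_at F T w))%N]].
Proof.
have range_sub z : submod_closed [in range_at F T z].
  exact: range_submod (inter_space_submod z (adm_submod F_admissible))
    (T_linear T_interpolating (z := z)).
have near_w w : fredholm_at F NF G NG T w -> \forall z \near w,
    fredholm_at F NF G NG T z /\ exists m n r, [/\ (r <= m)%N, (r <= n)%N,
      has_qdim (ker_at F T z) [set 0] (m - r) /\
        has_qdim (inter_space G z) (range_at F T z) (n - r),
      qdim (ker_at F T w) [set 0] = m & qdim (inter_space G w) (range_at F T w) = n].
  move=> [_ [m mP] _ [n nP]].
  have := fredholm_near delta_eq0 delta_continuous U_locally_compact Z_hausdorff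
    W_hausdorff F_admissible G_admissible T_interpolating mP nP.
  apply: filterS => z [Tz [r [rm rn kz cz]]]; split=> //; exists m, n, r; split=> //.
    exact: qdimE (@submod_set0 _ _) mP.
  exact: qdimE (range_sub w) nP.
split.
- by rewrite openE => w /near_w; apply: filterS => z [].
- move=> w /near_w; apply: filterS => z [_ [m [n [r [rm rn [kz cz] mE nE]]]]] _.
  rewrite /index_at /fredholm_index -/(ker_at F T z) -/(ker_at F T w).
  rewrite -/(range_at F T z) -/(range_at F T w) mE nE.
  rewrite (qdimE (@submod_set0 _ _) kz) (qdimE (range_sub z) cz).
  (* The common [r] cancels: (m - r) - (n - r) = m - n. *)
  by rewrite -!subzn// opprB addrA subrK.
- move=> w /near_w; apply: filterS => z [_ [m [n [r [rm rn [kz cz] -> ->]]]]].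
  rewrite (qdimE (@submod_set0 _ _) kz) (qdimE (range_sub z) cz) !leq_subr.
  by split=> //; [exists (m - r)%N|exists (n - r)%N].
Qed.
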